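(* Let $\beta$ be a well-formed execution of the SODA algorithm described in the context (in which at most $f$ servers crash), and let $\Pi$ be the set of all client operations that take place in $\beta$. Then every operation $\pi\in\Pi$ invoked by a non-faulty (non-crashing) client completes.
   Context: System model: asynchronous message passing with writers $\mathcal{W}$, readers $\mathcal{R}$ and $n$ servers $\mathcal{S}$ ordered $s_1<\dots<s_n$; reliable point-to-point channels between every client and server and every two servers (message eventually delivered if destination does not crash, even if the sender crashes; arbitrary delays and order). Processes fail by crashing only; any number of clients and at most $f$ servers crash, $1\le f\le (n-1)/2$. Well-formed: each client invokes an operation only after its previous one completed. Coding: values in a set $V$ with initial value $v_0$; an $[n,k]$ MDS code with $k=n-f$, encoder $\Phi$ ($\Phi_s(v)$ = coded element for server $s$) and decoder $\Phi^{-1}$ recovering $v$ from any $k$ coded elements of $v$ (with known server indices). Tags: pairs $t=(z,w)$, $z\in\mathbb{N}$, $w\in\mathcal{W}$, with $t_2>t_1$ iff $t_2.z>t_1.z$, or $t_2.z=t_1.z$ and $t_2.w>t_1.w$; $t_0$ is the initial tag (smaller than all others). Dissemination primitives. md-value-send$(t,v)$ by a writer: $(t,v)$ is sent to servers $s_1,\dots,s_{f+1}$; each such $s_i$, on first receipt, forwards $(t,v)$ to $s_{i+1},\dots,s_{f+1}$, sends $(t,\Phi_{s'}(v))$ to every other server $s'$, and then delivers $(t,\Phi_{s_i}(v))$ locally; each other server delivers the coded element $(t,\Phi_{s}(v))$ it receives (''md-value-deliver''). md-meta-send$(m)$: identical, except every server delivers the metadata message $m$ itself (''md-meta-deliver'').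 Each server delivers each disseminated message once. SODA writer $w$, write$(v)$: (get-tag) send a tag query to all servers, wait for responses (their locally stored tags) from a majority, let $t_{max}$ be the highest; (put) set $t_w=(t_{max}.z+1,w)$, invoke md-value-send$(t_w,v)$, wait for acknowledgments from $k$ servers, terminate. SODA reader $r$, read: (get-tag) query all servers for their tags, wait for a majority, let $t_r$ be the highest; (get-data) invoke md-meta-send(READ-VALUE,$(r,t_r)$), and collect received pairs $(t,c)$ until $k$ of them, from distinct servers, carry the same tag $t_{read}$; decode $v=\Phi^{-1}$ of these $k$ coded elements; (complete) invoke md-meta-send(READ-COMPLETE,$(r,t_r)$) and return $v$. (Each read carries a unique identifier in addition to $r$.) SODA server $s$: state: a pair $(t,c_s)$, initially $(t_0,\Phi_s(v_0))$; a set $R_c$ of registered pairs $(r,t_r)$, initially empty; a set $H$ of triples $(t,s',r)$, initially empty. On a tag query from a writer or reader: reply with local $t$. On md-value-deliver$(t_w,c'_s)$: for each $(r,t_r)\in R_c$ with $t_w\ge t_r$: send $(t_w,c'_s)$ to $r$, add $(t_w,s,r)$ to $H$, invoke md-meta-send(READ-DISPERSE,$(t_w,s,r)$); then if $t_w>t$ set $(t,c_s)\gets(t_w,c'_s)$; send an acknowledgment to the writer. On md-meta-deliver(READ-VALUE,$(r,t_r)$): if $(t_0,s,r)\in H$, remove from $H$ all triples with reader $r$; else add $(r,t_r)$ to $R_c$ and, if $t\ge t_r$, send $(t,c_s)$ to $r$, add $(t,s,r)$ to $H$ and invoke md-meta-send(READ-DISPERSE,$(t,s,r)$). On md-meta-deliver(READ-COMPLETE,$(r,t_r)$):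 if some $(r,t'_r)\in R_c$, remove it and remove all triples with reader $r$ from $H$; else add $(t_0,s,r)$ to $H$. On md-meta-deliver(READ-DISPERSE,$(t,s',r)$): add $(t,s',r)$ to $H$; if some $(r,t_r)\in R_c$ and the number of triples in $H$ with tag $t$ and reader $r$ is at least $k$, remove $(r,t_r)$ from $R_c$ and remove all triples with reader $r$ from $H$. *)

(* Defs.v *)
From mathcomp Require Import all_boot.

Set Implicit Arguments.
Unset Strict Implicit.
Unset Printing Implicit Defensive.

(* Servers are 0, 1, ..., n-1 (server s_i of the paper is index i-1, so the  *)
(* order s_1 < ... < s_n is the order on nat).  Writers and readers are      *)
(* identified by natural numbers (any number of clients).                    *)

Definition pid := ((nat + nat) + nat)%type.
Definition PW (w : nat) : pid := inl (inl w).
Definition PR (r : nat) : pid := inl (inr r).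
Definition PS (s : nat) : pid := inr s.

(* tags t = (z, w), ordered lexicographically; t0 = (0,0) is smaller than
   every tag produced by a writer (whose z component is >= 1) *)
Definition tag := (nat * nat)%type.
Definition t0 : tag := (0, 0).
Definition tag_lt (t1 t2 : tag) : bool :=
  (t1.1 < t2.1) || ((t1.1 == t2.1) && (t1.2 < t2.2)).
Definition tag_le (t1 t2 : tag) : bool := (t1 == t2) || tag_lt t1 t2.
Definition tag_max (t1 t2 : tag) : tag := if tag_lt t1 t2 then t2 else t1.
Definition max_tag (ts : seq tag) : tag := foldr tag_max t0 ts.

(* read identifiers: (reader r, per-reader operation counter) -- the
   unique identifier carried by each read together with r *)
Definition rid := (nat * nat)%type.
(* operation identifiers (client, per-client operation counter) *)
Definition opid := (pid * nat)%type.

Definition meta := (((rid * tag) + (rid * tag)) + ((tag * nat) * rid))%type.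
Definition ReadValue (r : rid) (tr : tag) : meta := inl (inl (r, tr)).
Definition ReadComplete (r : rid) (tr : tag) : meta := inl (inr (r, tr)).
Definition ReadDisperse (t : tag) (s : nat) (r : rid) : meta := inr (t, s, r).

Section SODA.
Variables (V C : Type).

Inductive msg :=
| MTagQuery of opid
| MTagResp of opid & tag
| MValFull of tag & V
| MValCoded of tag & C
| MAck of tag
| MData of rid & tag & C
| MMeta of meta.

(* pending local actions of a process, executed in order (a process can
   crash between any two of them) *)
Inductive out :=
| OSend of pid & msg
| OValDeliver of tag & C
| OMetaDeliver of meta
| OReturn.

Inductive wphase :=
| WIdle
| WGetTag of V & seq (nat * tag)
| WPut of tag & seq nat.             (* t_w, servers that acked   *)
Record wstate := WState { wcnt : nat; wph : wphase }.

Inductive rphase :=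
| RIdle
| RGetTag of seq (nat * tag)
| RGetData of tag & seq ((nat * tag) * C)
| RComplete of tag & V.
Record rstate := RState { rcnt : nat; rph : rphase }.

Record sstate := SState {
  stag : tag;
  sval : C;
  sRc : seq (rid * tag);
  sH : seq ((tag * nat) * rid);
  sseenv : seq tag;                 (* value disseminations already got   *)
  sseenm : seq meta }.              (* meta disseminations already got    *)

Record state := State {
  net : nat -> option ((pid * pid) * msg);  (* in-transit packets by id:
                                               (source, destination, msg) *)
  nuid : nat;
  crashed : pid -> bool;
  outbox : pid -> seq out;
  wst : nat -> wstate;
  rst : nat -> rstate;
  sst : nat -> sstate }.

Inductive action :=
| AInvokeWrite of nat & V
| AInvokeRead of nat
| AInternal of pid
| ADeliver of nat
| ACrash of pid
| ASkip.

Definition upd (K : eqType) (X : Type) (g : K -> X) (x : K) (y : X) : K -> X :=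
  fun z => if z == x then y else g z.

Definition set_add (T : eqType) (x : T) (s : seq T) : seq T :=
  if x \in s then s else rcons s x.

Definition srv_of (p : pid) : option nat :=
  match p with inr s => Some s | _ => None end.

Fixpoint dedupf (seen : seq nat) (l : seq (nat * C)) : seq (nat * C) :=
  match l with
  | [::] => [::]
  | x :: l' => if x.1 \in seen then dedupf seen l' else x :: dedupf (x.1 :: seen) l'
  end.

Section Algo.
Variables (v0 : V) (n f : nat) (Phi : nat -> V -> C) (Dec : seq (nat * C) -> V).

Definition kk := n - f.

Definition first_servers := iota 0 f.+1.

Definition meta_send (m : meta) : seq out :=
  [seq OSend (PS j) (MMeta m) | j <- first_servers].

Definition set_sH (st : sstate) H :=
  SState (stag st) (sval st) (sRc st) H (sseenv st) (sseenm st).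
Definition set_sRcH (st : sstate) Rc H :=
  SState (stag st) (sval st) Rc H (sseenv st) (sseenm st).

Definition val_deliver (s : nat) (st : sstate) (tw : tag) (c : C)
    : sstate * seq out :=
  let regs := [seq x <- sRc st | tag_le x.2 tw] in
  let outs := flatten [seq OSend (PR x.1.1) (MData x.1 tw c)
                             :: meta_send (ReadDisperse tw s x.1) | x <- regs] in
  let H' := foldl (fun H x => set_add (tw, s, x.1) H) (sH st) regs in
  let upd_t := tag_lt (stag st) tw in
  (SState (if upd_t then tw else stag st) (if upd_t then c else sval st)
          (sRc st) H' (sseenv st) (sseenm st),
   outs ++ [:: OSend (PW tw.2) (MAck tw)]).

Definition meta_deliver (s : nat) (st : sstate) (m : meta) : sstate * seq out :=
  match m with
  | inl (inl (r, tr)) =>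
      if (t0, s, r) \in sH st then (set_sH st [seq x <- sH st | x.2 != r], [::])
      else
        let Rc' := rcons (sRc st) (r, tr) in
        if tag_le tr (stag st) then
          (set_sRcH st Rc' (set_add (stag st, s, r) (sH st)),
           OSend (PR r.1) (MData r (stag st) (sval st))
             :: meta_send (ReadDisperse (stag st) s r))
        else (set_sRcH st Rc' (sH st), [::])
  | inl (inr (r, tr)) =>
      if has (fun x => x.1 == r) (sRc st) then
        (set_sRcH st [seq x <- sRc st | x.1 != r] [seq x <- sH st | x.2 != r], [::])
      else (set_sH st (set_add (t0, s, r) (sH st)), [::])
  | inr (t, s', r) =>
      let H' := set_add (t, s', r) (sH st) in
      if has (fun x => x.1 == r) (sRc st)
         && (kk <= count (fun x => (x.1.1 == t) && (x.2 == r)) H') then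
        (set_sRcH st [seq x <- sRc st | x.1 != r] [seq x <- H' | x.2 != r], [::])
      else (set_sH st H', [::])
  end.

Definition srv_recv (s : nat) (st : sstate) (src : pid) (m : msg) : sstate * seq out :=
  match m with
  | MTagQuery op => (st, [:: OSend src (MTagResp op (stag st))])
  | MValFull t v =>
      if (s <= f) && (t \notin sseenv st) then
        (SState (stag st) (sval st) (sRc st) (sH st) (t :: sseenv st) (sseenm st),
         [seq OSend (PS j) (MValFull t v) | j <- iota s.+1 (f - s)]
         ++ [seq OSend (PS j) (MValCoded t (Phi j v)) | j <- iota f.+1 (n - f.+1)]
         ++ [:: OValDeliver t (Phi s v)])
      else (st, [::])
  | MValCoded t c =>
      if (f < s) && (t \notin sseenv st) then
        (SState (stag st) (sval st) (sRc st) (sH st) (t :: sseenv st) (sseenm st),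
         [:: OValDeliver t c])
      else (st, [::])
  | MMeta mm =>
      if mm \notin sseenm st then
        (SState (stag st) (sval st) (sRc st) (sH st) (sseenv st) (mm :: sseenm st),
         (if s <= f then
            [seq OSend (PS j) (MMeta mm) | j <- iota s.+1 (f - s)]
            ++ [seq OSend (PS j) (MMeta mm) | j <- iota f.+1 (n - f.+1)]
          else [::])
         ++ [:: OMetaDeliver mm])
      else (st, [::])
  | _ => (st, [::])
  end.

Definition majority (m : nat) : bool := n < 2 * m.

Definition wr_recv (w : nat) (ws : wstate) (src : pid) (m : msg) : wstate * seq out :=
  match wph ws, m, srv_of src with
  | WGetTag v rs, MTagResp op t, Some s =>
      if (op == (PW w, wcnt ws)) && (s \notin map fst rs) then
        let rs' := rcons rs (s, t) in
        if majority (size rs') then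
          let tw := ((max_tag (map snd rs')).1.+1, w) in
          (WState (wcnt ws) (WPut tw [::]),
           [seq OSend (PS j) (MValFull tw v) | j <- first_servers])
        else (WState (wcnt ws) (WGetTag v rs'), [::])
      else (ws, [::])
  | WPut tw acks, MAck t, Some s =>
      if (t == tw) && (s \notin acks) then
        let acks' := rcons acks s in
        if kk <= size acks' then (WState (wcnt ws) WIdle, [::])
        else (WState (wcnt ws) (WPut tw acks'), [::])
      else (ws, [::])
  | _, _, _ => (ws, [::])
  end.

Definition rd_recv (r : nat) (rs : rstate) (src : pid) (m : msg) : rstate * seq out :=
  let id : rid := (r, rcnt rs) in
  match rph rs, m, srv_of src with
  | RGetTag resp, MTagResp op t, Some s =>
      if (op == (PR r, rcnt rs)) && (s \notin map fst resp) then
        let resp' := rcons resp (s, t) in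
        if majority (size resp') then
          let tr := max_tag (map snd resp') in
          (RState (rcnt rs) (RGetData tr [::]), meta_send (ReadValue id tr))
        else (RState (rcnt rs) (RGetTag resp'), [::])
      else (rs, [::])
  | RGetData tr recv, MData i t c, Some s =>
      if i == id then
        let recv' := rcons recv (s, t, c) in
        let elems := dedupf [::] [seq (x.1.1, x.2) | x <- recv' & x.1.2 == t] in
        if kk <= size elems then
          let v := Dec (take kk elems) in
          (RState (rcnt rs) (RComplete tr v),
           meta_send (ReadComplete id tr) ++ [:: OReturn])
        else (RState (rcnt rs) (RGetData tr recv'), [::])
      else (rs, [::])
  | _, _, _ => (rs, [::])
  end.

Definition set_outbox (p : pid) os (σ : state) :=
  State (net σ) (nuid σ) (crashed σ) (upd (outbox σ) p os) (wst σ) (rst σ) (sst σ).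
Definition set_wst w ws (σ : state) :=
  State (net σ) (nuid σ) (crashed σ) (outbox σ) (upd (wst σ) w ws) (rst σ) (sst σ).
Definition set_rst r rs (σ : state) :=
  State (net σ) (nuid σ) (crashed σ) (outbox σ) (wst σ) (upd (rst σ) r rs) (sst σ).
Definition set_sst s ss (σ : state) :=
  State (net σ) (nuid σ) (crashed σ) (outbox σ) (wst σ) (rst σ) (upd (sst σ) s ss).

Definition init : state :=
  State (fun _ => None) 0 (fun _ => false) (fun _ => [::])
        (fun _ => WState 0 WIdle) (fun _ => RState 0 RIdle)
        (fun s => SState t0 (Phi s v0) [::] [::] [::] [::]).

(* process dst (whose outbox is empty) handles the receipt of m from src *)
Definition receive (dst src : pid) (m : msg) (σ : state) : state :=
  match dst with
  | inl (inl w) => let (ws, os) := wr_recv w (wst σ w) src m in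
                   set_outbox dst os (set_wst w ws σ)
  | inl (inr r) => let (rs, os) := rd_recv r (rst σ r) src m in
                   set_outbox dst os (set_rst r rs σ)
  | inr s => let (ss, os) := srv_recv s (sst σ s) src m in
             set_outbox dst os (set_sst s ss σ)
  end.

Definition process (p : pid) (o : out) (rest : seq out) (σ : state) : state :=
  match o with
  | OSend dst m =>
      set_outbox p rest
        (State (upd (net σ) (nuid σ) (Some (p, dst, m))) (nuid σ).+1 (crashed σ)
               (outbox σ) (wst σ) (rst σ) (sst σ))
  | OValDeliver t c =>
      match p with
      | inr s => let (ss, os) := val_deliver s (sst σ s) t c in
                 set_outbox p (os ++ rest) (set_sst s ss σ)
      | _ => set_outbox p rest σ
      end
  | OMetaDeliver mm =>
      match p with
      | inr s => let (ss, os) := meta_deliver s (sst σ s) mm in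
                 set_outbox p (os ++ rest) (set_sst s ss σ)
      | _ => set_outbox p rest σ
      end
  | OReturn =>
      match p with
      | inl (inr r) => set_outbox p rest (set_rst r (RState (rcnt (rst σ r)) RIdle) σ)
      | _ => set_outbox p rest σ
      end
  end.

Definition next (σ : state) (a : action) : option state :=
  match a with
  | ASkip => Some σ
  | ACrash p =>
      Some (State (net σ) (nuid σ) (upd (crashed σ) p true) (outbox σ)
                  (wst σ) (rst σ) (sst σ))
  | AInvokeWrite w v =>
      (* well-formedness: only when the previous operation has completed *)
      if ~~ crashed σ (PW w) && (if wph (wst σ w) is WIdle then true else false)
         && nilp (outbox σ (PW w)) then
        let c := (wcnt (wst σ w)).+1 in
        Some (set_outbox (PW w) [seq OSend (PS j) (MTagQuery (PW w, c)) | j <- iota 0 n]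
               (set_wst w (WState c (WGetTag v [::])) σ))
      else None
  | AInvokeRead r =>
      if ~~ crashed σ (PR r) && (if rph (rst σ r) is RIdle then true else false)
         && nilp (outbox σ (PR r)) then
        let c := (rcnt (rst σ r)).+1 in
        Some (set_outbox (PR r) [seq OSend (PS j) (MTagQuery (PR r, c)) | j <- iota 0 n]
               (set_rst r (RState c (RGetTag [::])) σ))
      else None
  | AInternal p =>
      if crashed σ p then None else
      match outbox σ p with
      | [::] => None
      | o :: rest => Some (process p o rest σ)
      end
  | ADeliver u =>
      match net σ u with
      | None => None
      | Some (src, dst, m) =>
          if crashed σ dst || ~~ nilp (outbox σ dst) then None
          else Some (receive dst src m
                 (State (upd (net σ) u None) (nuid σ) (crashed σ) (outbox σ)
                        (wst σ) (rst σ) (sst σ)))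
      end
  end.

Definition execution (σ : nat -> state) (a : nat -> action) : Prop :=
  σ 0 = init /\ forall i, next (σ i) (a i) = Some (σ i.+1).

(* reliable channels and fair scheduling of local steps *)
Definition fair (σ : nat -> state) (a : nat -> action) : Prop :=
  (forall i u src dst m, net (σ i) u = Some (src, dst, m) ->
     exists j, i <= j /\ (a j = ADeliver u \/ crashed (σ j) dst))
  /\
  (forall i p, outbox (σ i) p <> [::] ->
     exists j, i <= j /\ (a j = AInternal p \/ crashed (σ j) p)).

Definition at_most_f_server_crashes (σ : nat -> state) : Prop :=
  forall i, count (fun s => crashed (σ i) (PS s)) (iota 0 n) <= f.

End Algo.
End SODA.

Arguments WIdle {V}.
Arguments RIdle {V C}.
Arguments ASkip {V}.

(* Main.v *)
(* Every message is traced back to the step that emitted it, and fairness carries it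
   forward to its receipt by any process that never crashes.

   Writes.  The [n - f] correct servers form a majority, so the tag query ends.  The new
   tag exceeds every earlier tag of the same writer, because the quorum that acknowledged
   an earlier write meets the queried majority; no server has therefore seen the new tag
   before, and each correct server delivers it and acknowledges while the writer waits.

   Reads.  Suppose a read waits for data forever.  Every correct server registers it.  If
   one of them unregisters it, then [k] servers have sent elements with one common tag.
   Otherwise all stay registered, and all eventually send their element for the largest
   among the requested tag and the tags they stored at registration.  In both cases the
   reader collects [k = n - f] elements with one tag, so it decodes. *)

From Stdlib Require List.
From mathcomp Require Import all_boot zify.
From Stdlib Require Import Classical.
Require Import Defs.

Set Implicit Arguments.
Unset Strict Implicit.
Unset Printing Implicit Defensive.
Local Notation In := List.In.

(** Three features of the model shape the proof. A process can crash between any two entries of its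
    outbox, so the effect of a broadcast depends on the order in which its copies are queued, and
    statements about dissemination become statements about this order. A server handles each
    dissemination only once, so an acknowledgment or element sent while the client is not yet
    waiting for it is never repeated; every delivery must therefore be placed in time relative to
    the phases of the client. Finally, READ-COMPLETE may overtake READ-VALUE and make a server
    refuse a registration, which has to be excluded for an unfinished read.

    A client that never becomes idle stays in one phase from some point on. The answers it has
    collected are then never dropped, so those of the individual correct servers accumulate until
    they exceed the threshold at which the phase would have ended. The bound [2 * f + 1 <= n] makes
    any [n - f] servers a majority and makes them meet every other majority. *)

(** * Membership in lists of outputs *)

Lemma In_map_mem (I : eqType) (X : Type) (g : I -> X) (l : seq I) (o : X) :
  In o [seq g k | k <- l] <-> exists2 k, k \in l & o = g k.
Proof.
elim: l => [|k l IH] /=; first by split=> // -[].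
split=> [[<-|/IH[k' lk' ->]]|[k' + oE]].
- by exists k => //; rewrite mem_head.
- by exists k' => //; rewrite inE lk' orbT.
- rewrite inE => /orP[/eqP<-|lk']; first by left.
  by right; apply/IH; exists k'.
Qed.

Lemma In_cat (X : Type) (l1 l2 : seq X) (o : X) :
  In o (l1 ++ l2) <-> In o l1 \/ In o l2.
Proof. by elim: l1 => [|x l1 IH] /=; [tauto | rewrite IH; tauto]. Qed.

Lemma In_flatten_map (I : eqType) (X : Type) (g : I -> seq X) (l : seq I) (o : X) :
  In o (flatten [seq g k | k <- l]) <-> exists2 k, k \in l & In o (g k).
Proof.
elim: l => [|k l IH] /=; first by split=> // -[].
rewrite In_cat IH; split=> [[go|[k' lk' go]]|[k' + go]].
- by exists k => //; rewrite mem_head.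
- by exists k' => //; rewrite inE lk' orbT.
- rewrite inE => /orP[/eqP<-|lk']; first by left.
  by right; exists k'.
Qed.

Arguments iota : simpl never.
Arguments val_deliver : simpl never.
Arguments meta_deliver : simpl never.
Arguments wr_recv : simpl never.
Arguments rd_recv : simpl never.
Arguments srv_recv : simpl never.

(** The transition functions stay folded under [/=], so their result can be destructed as an opaque
    pair. This suffices wherever only the affected component matters. *)
Ltac split_pair :=
  match goal with
  | |- context [@val_deliver ?a ?b ?c ?d ?e ?g ?h] => case: (@val_deliver a b c d e g h)
  | |- context [@meta_deliver ?a ?b ?c ?d ?e ?g ?h] => case: (@meta_deliver a b c d e g h)
  | |- context [@wr_recv ?a ?b ?c ?d ?e ?g ?h ?i] => case: (@wr_recv a b c d e g h i)
  | |- context [@rd_recv ?a ?b ?c ?d ?e ?g ?h ?i ?j] => case: (@rd_recv a b c d e g h i j)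
  | |- context [@srv_recv ?a ?b ?c ?d ?e ?g ?h ?i ?j] => case: (@srv_recv a b c d e g h i j)
  end.

(** * Tags *)

(** The lexicographic order is total; as a negated strict comparison, [tag_le] becomes arithmetic
    that [lia] can decide. *)
Lemma tag_leE (t1 t2 : tag) : tag_le t1 t2 = ~~ tag_lt t2 t1.
Proof.
case: t1 t2 => [a b] [c d]; rewrite /tag_le /tag_lt xpair_eqE /=; lia.
Qed.

Lemma tag_le_refl t : tag_le t t.
Proof. by rewrite /tag_le eqxx. Qed.

Lemma tag_le_trans t2 t1 t3 : tag_le t1 t2 -> tag_le t2 t3 -> tag_le t1 t3.
Proof.
case: t1 t2 t3 => [a b] [c d] [e g]; rewrite !tag_leE /tag_lt /=; lia.
Qed.

Lemma tag_ltW t1 t2 : tag_lt t1 t2 -> tag_le t1 t2.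
Proof. by rewrite /tag_le orbC => ->. Qed.

Lemma t0_le t : tag_le t0 t.
Proof. rewrite tag_leE /tag_lt /=; lia. Qed.

Lemma tag_max_geL t1 t2 : tag_le t1 (tag_max t1 t2).
Proof. by rewrite /tag_max; case: ifP => [/tag_ltW|_] //; exact: tag_le_refl. Qed.

Lemma tag_max_geR t1 t2 : tag_le t2 (tag_max t1 t2).
Proof.
by rewrite /tag_max; case: ifP => [_|E]; rewrite ?tag_le_refl // tag_leE E.
Qed.

Lemma max_tag_ge t ts : t \in ts -> tag_le t (max_tag ts).
Proof.
elim: ts => // t' ts IH; rewrite inE => /orP[/eqP->|/IH h] /=; first exact: tag_max_geL.
exact: tag_le_trans h (tag_max_geR _ _).
Qed.

Lemma max_tag_mem ts : max_tag ts = t0 \/ max_tag ts \in ts.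
Proof.
elim: ts => [|t ts IH]; first by left.
right; rewrite /= /tag_max; case: ifP => [lt|_]; last by rewrite mem_head.
case: IH => [E|]; last by rewrite inE orbC => ->.
by move: lt; rewrite E; have := t0_le t; rewrite tag_leE => /negPf->.
Qed.

(** * Splitting lists of outputs *)

(** Deliveries are the only outputs whose execution can queue further outputs. Counting them gives
    the measure by which an outbox drains. *)
Definition is_del (V C : Type) (o : out V C) :=
  match o with OValDeliver _ _ | OMetaDeliver _ => true | _ => false end.

Lemma count_eq0 (X : Type) (P : pred X) (l : seq X) :
  (forall o, In o l -> ~~ P o) -> count P l = 0.
Proof.
elim: l => //= o l IH h; rewrite IH => [|o' lo']; last by apply: h; right.
by rewrite (negPf (h o (or_introl erefl))).
Qed.

Lemma In_split (X : Type) (l : seq X) (o : X) :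
  In o l -> exists x y, l = x ++ o :: y.
Proof.
elim: l => //= o' l IH [->|/IH[x [y ->]]]; first by exists [::], l.
by exists (o' :: x), y.
Qed.

Lemma cat_split (X : Type) (l1 l2 x : seq X) (o : X) (y : seq X) :
  l1 ++ l2 = x ++ o :: y ->
  (exists y', l1 = x ++ o :: y') \/ (exists x', x = l1 ++ x' /\ l2 = x' ++ o :: y).
Proof.
elim: l1 x => [|h l1 IH] x /=; first by move=> E; right; exists x.
case: x => [|h' x] /= [-> E]; first by left; exists l1.
case/IH: E => [[y' ->]|[x' [-> E]]]; first by left; exists y'.
by right; exists x'.
Qed.

(** Splitting a broadcast at one copy shows which copies are queued ahead of it, and so survive a
    crash that comes after it. *)
Lemma map_iota_split (X : Type) (g : nat -> X) m d x o y :
  [seq g k | k <- iota m d] = x ++ o :: y ->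
  exists k, [/\ m <= k < m + d, o = g k & forall j, m <= j < k -> In (g j) x].
Proof.
elim: d m x => [|d IH] m x; first by case: x.
case: x => [|h x] /= [E1 E2].
  by exists m; split=> // [|j]; lia.
case: (IH _ _ E2) => k [mk -> hk]; exists k; split=> // [|j jk]; first lia.
have [->|ne] := eqVneq j m; first by left.
by right; apply: hk; lia.
Qed.

Lemma flatten_split (I : eqType) (X : Type) (g : I -> seq X) l x o y :
  flatten [seq g k | k <- l] = x ++ o :: y ->
  exists k x0 x1 y1, [/\ k \in l, g k = x1 ++ o :: y1 & x = x0 ++ x1].
Proof.
elim: l x => [|k l IH] x /=; first by case: x.
move=> /(@cat_split _ _ _ _ _ _) [[y' E]|[x' [-> /IH[k' [x0 [x1 [y1 [lk E ->]]]]]]]].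
  by exists k, [::], x, y'; rewrite mem_head.
by exists k', (g k ++ x0), x1, y1; rewrite inE lk orbT catA.
Qed.

Lemma In_prefix (X : Type) (l x : seq X) o y : l = x ++ o :: y -> In o l.
Proof. by move=> ->; apply/In_cat; right; left. Qed.

(** * Quorums *)

(** Each property persists once it holds, so the finitely many moments can be replaced by their
    sum. *)
Lemma eventually_all (G : seq nat) (P : nat -> nat -> Prop) :
  (forall s j k, P s j -> j <= k -> P s k) ->
  (forall s, s \in G -> exists j, P s j) ->
  exists j, forall s, s \in G -> P s j.
Proof.
move=> up; elim: G => [|s G IH] ex; first by exists 0.
case: IH => [s' s'G|j hj]; first by apply: ex; rewrite inE s'G orbT.
case: (ex s (mem_head _ _)) => j' hj'.
exists (j + j') => s'; rewrite inE => /orP[/eqP->|/hj h].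
  by apply: up hj' _; exact: leq_addl.
by apply: up h _; exact: leq_addr.
Qed.

(** Pigeonhole: disjoint lists would concatenate to a duplicate-free list of more than [n] numbers
    below [n]. *)
Lemma quorum_meet (A B : seq nat) n : uniq A -> uniq B ->
  (forall s, s \in A -> s < n) -> (forall s, s \in B -> s < n) ->
  n < size A + size B -> exists2 s, s \in A & s \in B.
Proof.
move=> uA uB An Bn lt; apply: NNPP => nex.
have uAB : uniq (A ++ B).
  rewrite cat_uniq uA uB andbT; apply/hasPn => s sB; apply/negP => sA.
  by case: nex; exists s.
have sub : {subset A ++ B <= iota 0 n}.
  by move=> s; rewrite mem_cat mem_iota => /orP[/An|/Bn].
by move: (uniq_leq_size uAB sub); rewrite size_iota size_cat leqNgt lt.
Qed.

Lemma mem_set_add (T : eqType) (x y : T) s : (y \in set_add x s) = (y == x) || (y \in s).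
Proof.
rewrite /set_add; case: ifP => xs; last by rewrite mem_rcons inE.
by case: eqP => [->|].
Qed.

Lemma set_add_uniq (T : eqType) (x : T) s : uniq s -> uniq (set_add x s).
Proof. by rewrite /set_add; case: ifPn => // xs us; rewrite rcons_uniq xs. Qed.

Lemma mem_foldl_set_add (T I : eqType) (g : I -> T) l y (s : seq T) :
  y \in foldl (fun s x => set_add (g x) s) s l -> y \in s \/ exists2 x, x \in l & y = g x.
Proof.
elim: l s => [|x l IH] s /=; first by left.
case/IH=> [|[x' x'l ->]]; last by right; exists x' => //; rewrite inE x'l orbT.
rewrite mem_set_add => /orP[/eqP->|]; last by left.
by right; exists x => //; rewrite mem_head.
Qed.

Lemma foldl_set_add_uniq (T I : eqType) (g : I -> T) l (s : seq T) :
  uniq s -> uniq (foldl (fun s x => set_add (g x) s) s l).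
Proof. by elim: l s => //= x l IH s us; apply/IH/set_add_uniq. Qed.

Lemma mem_dedupf (C : Type) seen (l : seq (nat * C)) s :
  s \in map fst l -> s \notin seen -> s \in map fst (dedupf seen l).
Proof.
elim: l seen => //= x l IH seen; rewrite inE => /orP[/eqP->|sl] sn.
  by rewrite (negPf sn) /= mem_head.
case: ifP => _; first exact: IH.
rewrite /= inE; case: eqP => //= ne; apply: IH => //.
by rewrite inE negb_or sn andbT; apply/eqP.
Qed.

(** The middle clause remembers the origin of the maximum: if it is not [tr], some server of [G]
    supplied it, and its dissemination can be traced. *)
Lemma max_among (G : seq nat) (P : nat -> tag -> Prop) tr :
  (forall s, s \in G -> exists t, P s t) ->
  exists t, [/\ tag_le tr t, t = tr \/ exists2 s, s \in G & P s t
    & forall s, s \in G -> exists2 t', P s t' & tag_le t' t].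
Proof.
elim: G => [|s G IH] ex; first by exists tr; split=> //; [exact: tag_le_refl | left].
case: IH => [s' s'G|t [le from up]]; first by apply: ex; rewrite inE s'G orbT.
case: (ex s (mem_head _ _)) => ts Pts.
exists (tag_max ts t); split.
- exact: tag_le_trans le (tag_max_geR _ _).
- rewrite /tag_max; case: ifP => _; last by right; exists s => //; rewrite mem_head.
  by case: from => [|[s' s'G Ps']]; [left | right; exists s' => //; rewrite inE s'G orbT].
- move=> s'; rewrite inE => /orP[/eqP->|/up[t' Pt' le']].
    by exists ts => //; exact: tag_max_geL.
  by exists t' => //; exact: tag_le_trans le' (tag_max_geR _ _).
Qed.

Lemma tag_le_anti t1 t2 : tag_le t1 t2 -> tag_le t2 t1 -> t1 = t2.
Proof.
by rewrite {1}/tag_le => /orP[/eqP//|lt]; rewrite tag_leE lt.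
Qed.

Section Soda.
Variables (V C : Type) (v0 : V) (n f : nat) (Phi : nat -> V -> C).
Variable Dec : seq (nat * C) -> V.

Arguments MTagQuery {V C}.
Arguments MTagResp {V C}.
Arguments MValFull {V C}.
Arguments MValCoded {V C}.
Arguments MAck {V C}.
Arguments MData {V C}.
Arguments MMeta {V C}.
Arguments OSend {V C}.
Arguments OValDeliver {V C}.
Arguments OMetaDeliver {V C}.
Arguments OReturn {V C}.
Arguments WPut {V}.
Arguments WGetTag {V}.
Arguments RGetTag {V C}.
Arguments RGetData {V C}.
Arguments RComplete {V C}.
Arguments AInternal {V}.
Arguments ADeliver {V}.
Arguments AInvokeRead {V}.
Arguments meta_send {V C}.

(** * Effect of one step on each component of the state *)

Definition handled st (src dst : pid) (m : msg V C) : seq (out V C) :=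
  match dst with
  | inl (inl w) => (wr_recv n f w (wst st w) src m).2
  | inl (inr r) => (rd_recv n f Dec r (rst st r) src m).2
  | inr s => (srv_recv n f Phi s (sst st s) src m).2
  end.

(** Every output is created here. The causes of messages are read off this function, without a
    second look at the transition relation. *)
Definition emits st (x : action V) (p : pid) : seq (out V C) :=
  match x with
  | AInvokeWrite w v =>
      if p == PW w then
        [seq OSend (PS j) (MTagQuery (PW w, (wcnt (wst st w)).+1)) | j <- iota 0 n]
      else [::]
  | AInvokeRead r =>
      if p == PR r then
        [seq OSend (PS j) (MTagQuery (PR r, (rcnt (rst st r)).+1)) | j <- iota 0 n]
      else [::]
  | AInternal q =>
      if p == q then
        match outbox st q, q with
        | OValDeliver t c :: _, inr s => (val_deliver V f s (sst st s) t c).2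
        | OMetaDeliver m :: _, inr s => (meta_deliver V n f s (sst st s) m).2
        | _, _ => [::]
        end
      else [::]
  | ADeliver u =>
      match net st u with
      | Some (src, dst, m) => if p == dst then handled st src dst m else [::]
      | None => [::]
      end
  | _ => [::]
  end.

Definition remains (st : state V C) (x : action V) (p : pid) : seq (out V C) :=
  match x with
  | AInternal q => if p == q then behead (outbox st p) else outbox st p
  | _ => outbox st p
  end.

(** New outputs always stand in front: invocations and receipts require an empty outbox, and
    deliveries prepend what they produce. *)
Lemma outbox_next st x st' p :
  Defs.next n f Phi Dec st x = Some st' -> outbox st' p = emits st x p ++ remains st x p.
Proof.
case: x => [w v|r|q|u|q|] /=.
- case: ifP => // /andP[_ /nilP Ho] [<-] /=; rewrite /upd.
  by case: eqP => [->|//]; rewrite Ho cats0.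
- case: ifP => // /andP[_ /nilP Ho] [<-] /=; rewrite /upd.
  by case: eqP => [->|//]; rewrite Ho cats0.
- case: ifP => // _; case Ho: (outbox st q) => [|o rest] // [<-].
  case: o Ho => [d m|t c|m|] Ho; case: q Ho => [[w|r]|s] Ho /=;
  try (split_pair => ss os /=);
  by rewrite /upd; case: eqP => [->|//]; rewrite Ho.
- case: (net st u) => [[[src dst] m]|//].
  case: ifP => // /norP[_]; rewrite negbK => /nilP Ho [<-].
  case: dst Ho => [[w|r]|s] Ho /=.
  + split_pair => ss os /=; rewrite /upd.
    by case: eqP => [->|//]; rewrite Ho cats0.
  + split_pair => ss os /=; rewrite /upd.
    by case: eqP => [->|//]; rewrite Ho cats0.
  + split_pair => ss os /=; rewrite /upd.
    by case: eqP => [->|//]; rewrite Ho cats0.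
- by case=> <-.
- by case=> <-.
Qed.

Lemma wst_next st x st' w :
  Defs.next n f Phi Dec st x = Some st' ->
  wst st' w =
    match x with
    | AInvokeWrite w' v =>
        if w == w' then WState (wcnt (wst st w)).+1 (WGetTag v [::]) else wst st w
    | ADeliver u =>
        if net st u is Some (src, dst, m) then
          if dst == PW w then (wr_recv n f w (wst st w) src m).1 else wst st w
        else wst st w
    | _ => wst st w
    end.
Proof.
case: x => [w' v|r|q|u|q|] /=.
- by case: ifP => // _ [<-] /=; rewrite /upd; case: eqP => [->|].
- by case: ifP => // _ [<-].
- case: ifP => // _; case: (outbox st q) => [|o rest] // [<-].
  by case: o => [d m|t c|m|] //=; case: q => [[?|?]|s] //=; split_pair.
- case: (net st u) => [[[src dst] m]|//].
  case: ifP => // _ [<-]; case: dst => [[w'|r]|s] /=.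
  + have [[->]|/eqP ne] := eqVneq (inl (inl w') : pid) (PW w);
      split_pair => ss os /=; rewrite /upd ?eqxx //.
    by case: eqP => // E; case: ne; rewrite E.
  + by split_pair.
  + by split_pair.
- by case=> <-.
- by case=> <-.
Qed.

Lemma rst_next st x st' r :
  Defs.next n f Phi Dec st x = Some st' ->
  rst st' r =
    match x with
    | AInvokeRead r' =>
        if r == r' then RState (rcnt (rst st r)).+1 (RGetTag [::]) else rst st r
    | AInternal q =>
        if (q == PR r) && (if outbox st q is OReturn :: _ then true else false)
        then RState (rcnt (rst st r)) RIdle else rst st r
    | ADeliver u =>
        if net st u is Some (src, dst, m) then
          if dst == PR r then (rd_recv n f Dec r (rst st r) src m).1 else rst st r
        else rst st r
    | _ => rst st r
    end.
Proof.
case: x => [w' v|r'|q|u|q|] /=.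
- by case: ifP => // _ [<-].
- by case: ifP => // _ [<-] /=; rewrite /upd; case: eqP => [->|].
- case: ifP => // _; case: (outbox st q) => [|o rest] // [<-].
  case: o => [d m|t c|m|] //=; case: q => [[?|?]|s] //=; rewrite ?andbF //; try by split_pair.
  rewrite /upd andbT /=.
  case: eqP => [->|ne]; first by rewrite eqxx.
  by case: eqP => // -[E]; case: ne.
- case: (net st u) => [[[src dst] m]|//].
  case: ifP => // _ [<-]; case: dst => [[w'|r']|s] /=.
  + by split_pair.
  + have [[->]|/eqP ne] := eqVneq (inl (inr r') : pid) (PR r);
      split_pair => ss os /=; rewrite /upd ?eqxx //.
    by case: eqP => // E; case: ne; rewrite E.
  + by split_pair.
- by case=> <-.
- by case=> <-.
Qed.

Lemma sst_next st x st' s :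
  Defs.next n f Phi Dec st x = Some st' ->
  sst st' s =
    match x with
    | AInternal q =>
        if q == PS s then
          match outbox st q with
          | OValDeliver t c :: _ => (val_deliver V f s (sst st s) t c).1
          | OMetaDeliver m :: _ => (meta_deliver V n f s (sst st s) m).1
          | _ => sst st s
          end
        else sst st s
    | ADeliver u =>
        if net st u is Some (src, dst, m) then
          if dst == PS s then (srv_recv n f Phi s (sst st s) src m).1 else sst st s
        else sst st s
    | _ => sst st s
    end.
Proof.
case: x => [w' v|r'|q|u|q|] /=.
- by case: ifP => // _ [<-].
- by case: ifP => // _ [<-].
- case: ifP => // _; case: (outbox st q) => [|o rest] // [<-].
  case: o => [d m|t c|m|] //=; case: q => [[?|?]|s'] //=; rewrite ?if_same //.
  + have [[->]|/eqP ne] := eqVneq (inr s' : pid) (PS s);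
      try (split_pair => ss os /=); rewrite /upd ?eqxx //.
    by case: eqP => // E; case: ne; rewrite E.
  + have [[->]|/eqP ne] := eqVneq (inr s' : pid) (PS s);
      try (split_pair => ss os /=); rewrite /upd ?eqxx //.
    by case: eqP => // E; case: ne; rewrite E.
- case: (net st u) => [[[src dst] m]|//].
  case: ifP => // _ [<-]; case: dst => [[w'|r']|s'] /=.
  + by split_pair.
  + by split_pair.
  + have [[->]|/eqP ne] := eqVneq (inr s' : pid) (PS s);
      try (split_pair => ss os /=); rewrite /upd ?eqxx //.
    by case: eqP => // E; case: ne; rewrite E.
- by case=> <-.
- by case=> <-.
Qed.

(* Only the fresh identifier [nuid] is ever written, so a packet in transit is never
   overwritten; with fairness this is what makes it arrive. *)
Lemma net_next st x st' u :
  Defs.next n f Phi Dec st x = Some st' ->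
  (net st' u = net st u)
  \/ (net st' u = None)
  \/ (u = nuid st /\ nuid st' = (nuid st).+1 /\
      exists p d m rest, [/\ x = AInternal p, outbox st p = OSend d m :: rest
                        & net st' u = Some (p, d, m)]).
Proof.
case: x => [w' v|r'|q|u'|q|] /=.
- by case: ifP => // _ [<-]; left.
- by case: ifP => // _ [<-]; left.
- case: ifP => // _; case Ho: (outbox st q) => [|o rest] // [<-].
  case: o Ho => [d m|t c|m|] /= Ho; last first.
  + by left; case: q Ho => [[?|?]|s'].
  + by left; case: q Ho => [[?|?]|s'] _ //=; split_pair.
  + by left; case: q Ho => [[?|?]|s'] _ //=; split_pair.
  + rewrite /upd; case: eqP => [->|_]; last by left.
    by right; right; split=> //; split=> //; exists q, d, m, rest.
- case: (net st u') => [[[src dst] m]|//].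
  case: ifP => // _ [<-].
  have E : net (receive n f Phi Dec dst src m (State (upd (net st) u' None) (nuid st)
     (crashed st) (outbox st) (wst st) (rst st) (sst st))) = upd (net st) u' None.
    case: dst => [[w'|r']|s'] /=; by [split_pair | split_pair | split_pair].
  by rewrite E /upd; case: eqP; auto.
- by case=> <-; left.
- by case=> <-; left.
Qed.

Lemma nuid_next st x st' :
  Defs.next n f Phi Dec st x = Some st' -> nuid st <= nuid st'.
Proof.
case: x => [w' v|r'|q|u'|q|] /=.
- by case: ifP => // _ [<-].
- by case: ifP => // _ [<-].
- case: ifP => // _; case Ho: (outbox st q) => [|o rest] // [<-].
  case: o Ho => [d m|t c|m|] /= _ //.
  + by case: q => [[?|?]|s'] //=; split_pair.
  + by case: q => [[?|?]|s'] //=; split_pair.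
  + by case: q => [[?|?]|s'].
- case: (net st u') => [[[src dst] m]|//].
  case: ifP => // _ [<-].
  by case: dst => [[w'|r']|s'] /=; [split_pair | split_pair | split_pair].
- by case=> <-.
- by case=> <-.
Qed.

Lemma net_send st q d m rest st' :
  outbox st q = OSend d m :: rest ->
  Defs.next n f Phi Dec st (AInternal q) = Some st' ->
  net st' (nuid st) = Some (q, d, m) /\ nuid st' = (nuid st).+1.
Proof.
by move=> Ho /=; case: ifP => // _; rewrite Ho => -[<-] /=; rewrite /upd eqxx.
Qed.

Lemma crashed_next st x st' p :
  Defs.next n f Phi Dec st x = Some st' -> crashed st p -> crashed st' p.
Proof.
case: x => [w' v|r'|q|u'|q|] /=.
- by case: ifP => // _ [<-].
- by case: ifP => // _ [<-].
- case: ifP => // _; case Ho: (outbox st q) => [|o rest] // [<-].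
  case: o Ho => [d m|t c|m|] /= _ //.
  + by case: q => [[?|?]|s'] //=; split_pair.
  + by case: q => [[?|?]|s'] //=; split_pair.
  + by case: q => [[?|?]|s'].
- case: (net st u') => [[[src dst] m]|//].
  case: ifP => // _ [<-].
  by case: dst => [[w'|r']|s'] /=; [split_pair | split_pair | split_pair].
- by case=> <- /=; rewrite /upd; case: eqP.
- by case=> <-.
Qed.

(** * Events of an execution *)

Variables (σ : nat -> state V C) (a : nat -> action V).
Hypothesis Hfn : 2 * f + 1 <= n.
Hypothesis Hexec : execution v0 n f Phi Dec σ a.

(** An output takes effect only from the head of its outbox, so this is the moment at which [p]
    executes [o]. *)
Definition headev i p o :=
  a i = AInternal p /\ exists rest, outbox (σ i) p = o :: rest.
Definition recvev i src dst m :=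
  exists u, a i = ADeliver u /\ net (σ i) u = Some (src, dst, m).
Definition emitted i p := emits (σ i) (a i) p.

Lemma step i : Defs.next n f Phi Dec (σ i) (a i) = Some (σ i.+1).
Proof. by case: Hexec. Qed.

Lemma outbox_step i p : outbox (σ i.+1) p = emitted i p ++ remains (σ i) (a i) p.
Proof. exact: outbox_next (step i). Qed.

Lemma receive_writer i src w m : recvev i src (PW w) m ->
  wst (σ i.+1) w = (wr_recv n f w (wst (σ i) w) src m).1
  /\ emitted i (PW w) = (wr_recv n f w (wst (σ i) w) src m).2.
Proof.
case=> u [ai nu]; rewrite (wst_next w (step i)) /emitted ai nu /emits ?nu !eqxx; split=> //.
Qed.

Lemma receive_reader i src r m : recvev i src (PR r) m ->
  rst (σ i.+1) r = (rd_recv n f Dec r (rst (σ i) r) src m).1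
  /\ emitted i (PR r) = (rd_recv n f Dec r (rst (σ i) r) src m).2.
Proof.
case=> u [ai nu]; rewrite (rst_next r (step i)) /emitted ai nu /emits ?nu !eqxx; split=> //.
Qed.

Lemma receive_server i src s m : recvev i src (PS s) m ->
  sst (σ i.+1) s = (srv_recv n f Phi s (sst (σ i) s) src m).1
  /\ emitted i (PS s) = (srv_recv n f Phi s (sst (σ i) s) src m).2.
Proof.
case=> u [ai nu]; rewrite (sst_next s (step i)) /emitted ai nu /emits ?nu !eqxx; split=> //.
Qed.

Lemma deliver_value i s t c : headev i (PS s) (OValDeliver t c) ->
  sst (σ i.+1) s = (val_deliver V f s (sst (σ i) s) t c).1
  /\ emitted i (PS s) = (val_deliver V f s (sst (σ i) s) t c).2.
Proof.
case=> ai [rest Ho]; rewrite (sst_next s (step i)) /emitted ai /emits eqxx Ho.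
by split.
Qed.

Lemma deliver_meta i s m : headev i (PS s) (OMetaDeliver m) ->
  sst (σ i.+1) s = (meta_deliver V n f s (sst (σ i) s) m).1
  /\ emitted i (PS s) = (meta_deliver V n f s (sst (σ i) s) m).2.
Proof.
case=> ai [rest Ho]; rewrite (sst_next s (step i)) /emitted ai /emits eqxx Ho.
by split.
Qed.

Lemma head_rest i p o : headev i p o -> exists rest,
  outbox (σ i) p = o :: rest /\ outbox (σ i.+1) p = emitted i p ++ rest.
Proof.
case=> ai [rest Ho]; exists rest; split=> //.
by rewrite outbox_step ai /= eqxx Ho.
Qed.

Lemma sst_cases i s :
  [\/ sst (σ i.+1) s = sst (σ i) s,
      exists src m, recvev i src (PS s) m,
      exists t c, headev i (PS s) (OValDeliver t c)
    | exists m, headev i (PS s) (OMetaDeliver m)].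
Proof.
rewrite (sst_next s (step i)); case ai: (a i) => [w v|r|q|u|q|]; try by constructor 1.
- case: eqP => [E|_]; last by constructor 1.
  case Ho: (outbox _ q) => [|[d m|t c|m|] rest]; try by constructor 1.
  + by constructor 3; exists t, c; split; [rewrite ai E | exists rest; rewrite -E].
  + by constructor 4; exists m; split; [rewrite ai E | exists rest; rewrite -E].
- case nu: (net _ u) => [[[src dst] m]|]; last by constructor 1.
  case: eqP => [E|_]; last by constructor 1.
  by constructor 2; exists src, m, u; rewrite nu E.
Qed.

Lemma wst_cases i w :
  [\/ wst (σ i.+1) w = wst (σ i) w,
      exists src m, recvev i src (PW w) m
    | exists v, a i = AInvokeWrite w v /\
        wst (σ i.+1) w = WState (wcnt (wst (σ i) w)).+1 (WGetTag v [::])].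
Proof.
rewrite (wst_next w (step i)); case ai: (a i) => [w' v|r|q|u|q|]; try by constructor 1.
- case: eqP => [E|_]; last by constructor 1.
  by constructor 3; exists v; rewrite E.
- case nu: (net _ u) => [[[src dst] m]|]; last by constructor 1.
  case: eqP => [E|_]; last by constructor 1.
  by constructor 2; exists src, m, u; rewrite nu E.
Qed.

Lemma rst_cases i r :
  [\/ rst (σ i.+1) r = rst (σ i) r,
      exists src m, recvev i src (PR r) m,
      headev i (PR r) OReturn /\
        rst (σ i.+1) r = RState (rcnt (rst (σ i) r)) RIdle
    | a i = AInvokeRead r /\
        rst (σ i.+1) r = RState (rcnt (rst (σ i) r)).+1 (RGetTag [::])].
Proof.
rewrite (rst_next r (step i)); case ai: (a i) => [w' v|r'|q|u|q|]; try by constructor 1.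
- case: eqP => [E|_]; last by constructor 1.
  by constructor 4; rewrite E.
- case: eqP => [E|_]; last by constructor 1.
  case Ho: (outbox _ q) => [|[d m|t c|m|] rest]; try by constructor 1.
  by constructor 3; split=> //; split; [rewrite ai E | exists rest; rewrite -E].
- case nu: (net _ u) => [[[src dst] m]|]; last by constructor 1.
  case: eqP => [E|_]; last by constructor 1.
  by constructor 2; exists src, m, u; rewrite nu E.
Qed.

(** * Causes of outputs *)

Definition cnt st (p : pid) :=
  match p with
  | inl (inl w) => wcnt (@wst V C st w)
  | inl (inr r) => rcnt (rst st r)
  | inr _ => 0
  end.

Definition invokes i p :=
  (exists w v, p = PW w /\ a i = AInvokeWrite w v)
  \/ (exists r, p = PR r /\ a i = AInvokeRead r).

(* [cause i p o] lists the reasons for which a step [i] may append [o] to the outbox of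
   [p]; inverting it at a given message replaces an invariant over the network. *)
Inductive cause (i : nat) : pid -> out V C -> Prop :=
| CQuery p k : k < n -> invokes i p ->
    cause i p (OSend (PS k) (MTagQuery (p, (cnt (σ i) p).+1)))
| CResp s q op : recvev i q (PS s) (MTagQuery op) ->
    cause i (PS s) (OSend q (MTagResp op (stag (sst (σ i) s))))
| CPut w v rs tw k : wph (wst (σ i) w) = WGetTag v rs ->
    wph (wst (σ i.+1) w) = WPut tw [::] -> tw.2 = w -> k <= f ->
    cause i (PW w) (OSend (PS k) (MValFull tw v))
| CFull s src t v k : recvev i src (PS s) (MValFull t v) -> s < k <= f ->
    cause i (PS s) (OSend (PS k) (MValFull t v))
| CCoded s src t v k : recvev i src (PS s) (MValFull t v) -> k < n ->
    cause i (PS s) (OSend (PS k) (MValCoded t (Phi k v)))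
| CValFull s src t v : recvev i src (PS s) (MValFull t v) ->
    t \notin sseenv (sst (σ i) s) -> t \in sseenv (sst (σ i.+1) s) ->
    cause i (PS s) (OValDeliver t (Phi s v))
| CValCoded s src t c : recvev i src (PS s) (MValCoded t c) ->
    t \notin sseenv (sst (σ i) s) -> t \in sseenv (sst (σ i.+1) s) ->
    cause i (PS s) (OValDeliver t c)
| CAck s t c : headev i (PS s) (OValDeliver t c) ->
    cause i (PS s) (OSend (PW t.2) (MAck t))
| CDataVal s t c r tr : headev i (PS s) (OValDeliver t c) ->
    (r, tr) \in sRc (sst (σ i) s) ->
    cause i (PS s) (OSend (PR r.1) (MData r t c))
| CDataReg s r tr : headev i (PS s) (OMetaDeliver (ReadValue r tr)) ->
    cause i (PS s)
      (OSend (PR r.1) (MData r (stag (sst (σ i) s)) (Defs.sval (sst (σ i) s))))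
| CDisperse s t r k : k < n ->
    (exists c, In (OSend (PR r.1) (MData r t c)) (emitted i (PS s))) ->
    cause i (PS s) (OSend (PS k) (MMeta (ReadDisperse t s r)))
| CReadValue r tr resp k : k < n ->
    rph (rst (σ i) r) = RGetTag resp ->
    rst (σ i.+1) r = RState (rcnt (rst (σ i) r)) (RGetData tr [::]) ->
    cause i (PR r) (OSend (PS k) (MMeta (ReadValue (r, rcnt (rst (σ i) r)) tr)))
| CReadComplete r tr v k : k < n ->
    rst (σ i.+1) r = RState (rcnt (rst (σ i) r)) (RComplete tr v) ->
    cause i (PR r) (OSend (PS k) (MMeta (ReadComplete (r, rcnt (rst (σ i) r)) tr)))
| CReturn r : cause i (PR r) OReturn
| CRelay s src m k : recvev i src (PS s) (MMeta m) -> k < n ->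
    cause i (PS s) (OSend (PS k) (MMeta m))
| CMeta s src m : recvev i src (PS s) (MMeta m) ->
    m \notin sseenm (sst (σ i) s) -> m \in sseenm (sst (σ i.+1) s) ->
    cause i (PS s) (OMetaDeliver m).

Lemma In_meta_send m o : In o (meta_send f m) ->
  exists2 k, k < n & o = OSend (PS k) (MMeta m) :> out V C.
Proof.
case/In_map_mem=> k; rewrite mem_iota => kf ->; exists k => //; lia.
Qed.

Lemma emitted_cause i p o : In o (emitted i p) -> cause i p o.
Proof.
move=> Hin; move: (Hin); rewrite {1}/emitted /emits; case ai: (a i) => [w v|r|q|u|q|] //.
- case: eqP => // -> /In_map_mem[k + ->]; rewrite mem_iota => /andP[_ kn].
  by apply: (@CQuery i (PW w)) => //; left; exists w, v.
- case: eqP => // -> /In_map_mem[k + ->]; rewrite mem_iota => /andP[_ kn].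
  by apply: (@CQuery i (PR r)) => //; right; exists r.
- case: eqP => // pq; subst q; case Ho: (outbox _ p) => [|[d m|t c|m|] rest] //;
    case: p ai Ho Hin => [[//|//]|s] ai Ho Hin; rewrite -/(PS s) in ai Ho Hin *.
  + have hd : headev i (PS s) (OValDeliver t c) by split=> //; exists rest.
    rewrite /val_deliver /= => /In_cat[|].
      case/In_flatten_map=> -[r tr]; rewrite mem_filter => /andP[le rin] /= [<-|].
        exact: (CDataVal hd rin).
      move=> om; case: (In_meta_send om) => k kn oE; rewrite oE.
      (* The announcement is queued in the same step as the data it announces, and [CDisperse] keeps
         this data as its witness. *)
      apply: CDisperse => //; exists c; rewrite (deliver_value hd).2 /val_deliver /=.
      apply/In_cat; left; apply/In_flatten_map; exists (r, tr); last by left.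
      by rewrite mem_filter le rin.
    by case=> // <-; exact: (CAck hd).
  + have hd : headev i (PS s) (OMetaDeliver m) by split=> //; exists rest.
    rewrite /meta_deliver; case: m {Ho} hd => [[[r tr]|[r tr]]|[[t s'] r]] hd; try by case: ifP.
    case: ifP => // nH; case: ifP => // le /= [<-|]; first exact: (CDataReg hd).
    move=> om; case: (In_meta_send om) => k kn oE; rewrite oE.
    apply: CDisperse => //; exists (Defs.sval (sst (σ i) s)).
    by rewrite (deliver_meta hd).2 /meta_deliver nH le; left.
- case nu: (net _ u) => [[[src dst] m]|] //; case: eqP => // pq; subst dst.
  have rc : recvev i src p m by exists u.
  case: p rc {nu Hin} => [[w|r]|s] rc.
  + rewrite -/(PW w) in rc *; have [+ _] := receive_writer rc.
    rewrite /handled /= /wr_recv /first_servers.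
    (* Generalizing the list keeps [/=] from unfolding [iota]. *)
    have [fs fsE] : exists fs, fs = iota 0 f.+1 by eexists.
    rewrite -fsE; case Hph: (wph _) => [|v rs|tw acks] //.
      case: m {rc} => [op|op t|t v'|t c|t|id t c|mm] //=; case: srv_of => //= s.
      case: ifP => //= _; case: ifP => //= _ wE.
      case/In_map_mem=> k; rewrite fsE mem_iota => kf ->.
      by apply: (CPut Hph) => //; rewrite ?wE //; lia.
    by case: m {rc} => [op|op t|t v'|t c|t|id t c|mm] //=;
      case: srv_of => //= s; case: ifP => //= _; case: ifP.
  + rewrite -/(PR r) in rc *; have [+ _] := receive_reader rc.
    rewrite /handled /= /rd_recv.
    have [ms msE] : exists ms, ms = @meta_send V C f by eexists.
    rewrite -msE; case Hph: (rph _) => [|resp|tr recv|tr v] //.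
      case: m {rc} => [op|op t|t v'|t c|t|id t c|mm] //=; case: srv_of => //= s.
      case: ifP => //= _; case: ifP => //= _ rE om.
      rewrite msE in om; case: (In_meta_send om) => k kn ->; exact: (CReadValue kn Hph rE).
    case: m {rc} => [op|op t|t v'|t c|t|id t c|mm] //=; case: srv_of => //= s;
      case: ifP => //= _; case: ifP => //= _ rE.
    case/In_cat=> [om|[<-|//]]; last exact: CReturn.
    rewrite msE in om; case: (In_meta_send om) => k kn ->; exact: (CReadComplete kn rE).
  + rewrite -/(PS s) in rc *; have [+ _] := receive_server rc.
    rewrite /handled /= /srv_recv; case: m rc => [op|op t|t v|t c|t|id t c|mm] rc //=.
    * by move=> _ /= [<-|//]; exact: CResp.
    * case: ifP => [/andP[sf nt]|//] /= sE /In_cat[|/In_cat[|]].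
      - case/In_map_mem=> k; rewrite mem_iota => kf ->; apply: (CFull rc); lia.
      - case/In_map_mem=> k; rewrite mem_iota => kf ->; apply: (CCoded rc); lia.
      - by case=> // <-; apply: (CValFull rc); rewrite // sE inE eqxx.
    * case: ifP => [/andP[sf nt]|//] /= sE [<-|//].
      by apply: (CValCoded rc); rewrite // sE inE eqxx.
    * case: ifP => [nt|//] /= sE /In_cat[|]; last first.
        by case=> // <-; apply: (CMeta rc); rewrite // sE inE eqxx.
      case: ifP => // sf /In_cat[|].
      - case/In_map_mem=> k; rewrite mem_iota => kf ->; apply: (CRelay rc); lia.
      - case/In_map_mem=> k; rewrite mem_iota => kf ->; apply: (CRelay rc); lia.
Qed.

(** * Tracing messages back in time *)

Lemma trace_mono (R : state V C -> state V C -> Prop) :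
  (forall s, R s s) -> (forall s1 s2 s3, R s1 s2 -> R s2 s3 -> R s1 s3) ->
  (forall i, R (σ i) (σ i.+1)) -> forall i j, i <= j -> R (σ i) (σ j).
Proof.
move=> Rr Rt Rs i j /subnK <-; elim: (j - i) => [|d IH] //.
by rewrite addSn; exact: Rt IH (Rs _).
Qed.

Lemma init0 : σ 0 = init v0 Phi.
Proof. by case: Hexec. Qed.

Lemma net_sent i u p q m : net (σ i) u = Some (p, q, m) ->
  exists2 j, j < i & headev j p (OSend q m).
Proof.
elim: i => [|i IH]; first by rewrite init0.
case: (net_next u (step i)) => [->|[->//|[_ [_ [p' [q' [m' [rest [ai Ho ->]]]]]]]]].
  by case/IH=> j ji hd; exists j => //; exact: ltnW.
by case=> <- <- <-; exists i => //; split=> //; exists rest.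
Qed.

Lemma recv_sent i p q m : recvev i p q m ->
  exists2 j, j < i & headev j p (OSend q m).
Proof. by case=> u [_ /net_sent]. Qed.

Lemma In_outbox_step i p o :
  In o (outbox (σ i.+1) p) -> In o (emitted i p) \/ In o (outbox (σ i) p).
Proof.
rewrite outbox_step => /In_cat[|H]; first by left.
right; move: H; rewrite /remains; case: (a i) => // q; case: eqP => // ->.
by case: (outbox _ _) => //= o' l; right.
Qed.

Lemma outbox_emitted i p o : In o (outbox (σ i) p) -> exists2 j, j < i & In o (emitted j p).
Proof.
elim: i => [|i IH]; first by rewrite init0.
case/In_outbox_step=> [|/IH[j ji oj]]; first by exists i.
by exists j => //; exact: ltnW.
Qed.

Lemma head_In i p o : headev i p o -> In o (outbox (σ i) p).
Proof. by case=> _ [rest ->]; left. Qed.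

Lemma head_emitted i p o : headev i p o -> exists2 j, j < i & In o (emitted j p).
Proof. by move/head_In/outbox_emitted. Qed.

(** The emission is strictly earlier than the receipt, which makes induction on time along chains of
    relays well founded. *)
Lemma recv_emitted i p q m : recvev i p q m ->
  exists2 j, j < i & In (OSend q m) (emitted j p).
Proof.
by case/recv_sent=> j ji /head_emitted[k kj ek]; exists k => //; exact: ltn_trans ji.
Qed.

(** Only these components grow. [sRc] and [sH] lose entries as well, so they are followed by
    separate case analyses. *)
Lemma sst_mono i j s : i <= j ->
  [/\ tag_le (stag (sst (σ i) s)) (stag (sst (σ j) s)),
      {subset sseenv (sst (σ i) s) <= sseenv (sst (σ j) s)}
    & {subset sseenm (sst (σ i) s) <= sseenm (sst (σ j) s)}].
Proof.
pose R (s1 s2 : state V C) :=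
  [/\ tag_le (stag (sst s1 s)) (stag (sst s2 s)),
      {subset sseenv (sst s1 s) <= sseenv (sst s2 s)}
    & {subset sseenm (sst s1 s) <= sseenm (sst s2 s)}].
apply: (trace_mono (R := R)) => [s1|s1 s2 s3 [a1 a2 a3] [b1 b2 b3]|k].
- by split=> //; exact: tag_le_refl.
- split; first exact: tag_le_trans a1 b1.
    by move=> x /a2/b2.
  by move=> x /a3/b3.
- rewrite /R; case: (sst_cases k s) => [->|[src [m rc]]|[t [c hd]]|[m hd]].
  + by split=> //; exact: tag_le_refl.
  + rewrite (receive_server rc).1 /srv_recv.
    by case: m rc => [op|op t|t v|t c|t|id t c|mm] _; try case: ifP => _;
      split=> //=; rewrite ?tag_le_refl // => x xs; rewrite inE xs orbT.
  + rewrite (deliver_value hd).1 /val_deliver; split=> //=.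
    by case: ifP => [/tag_ltW|] //; rewrite tag_le_refl.
  + rewrite (deliver_meta hd).1 /meta_deliver.
    by case: m {hd} => [[[r tr]|[r tr]]|[[t s'] r]];
      repeat case: ifP => _; split=> //=; rewrite ?tag_le_refl.
Qed.

(** Deliveries are queued by receipts alone, so executing an output never queues one. *)
Lemma del_AInternal i p : a i = AInternal p -> count (@is_del V C) (emitted i p) = 0.
Proof.
move=> ai; apply: count_eq0 => o /emitted_cause.
by case=> // s src; [move=> t v | move=> t c | move=> m]; case=> u []; rewrite ai.
Qed.

Lemma del_emitted i p : count (@is_del V C) (emitted i p) <= 1.
Proof.
case ai: (a i) => [w v|r|q|u|q|]; rewrite /emitted ai /emits //.
- by case: ifP => // _; rewrite count_eq0 // => o /In_map_mem[k _ ->].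
- by case: ifP => // _; rewrite count_eq0 // => o /In_map_mem[k _ ->].
- have [pq|//] := eqVneq p q.
  by have := del_AInternal ai; rewrite /emitted ai /emits eqxx => ->.
- case nu: (net _ _) => [[[src dst] m]|] //; have [_|//] := eqVneq p dst.
  have := emitted_cause (i := i) (p := dst); rewrite /emitted ai /emits nu eqxx => ec.
  case: dst nu ec => [x|s] nu ec; first by rewrite count_eq0 // => o /ec oc; inversion oc.
  rewrite /handled /srv_recv; case: m {nu ec} => [op|op t|t v|t c|t|id t c|mm] //=;
   case: ifP => //= _; rewrite !count_cat /= ?addn1.
  + by rewrite !count_eq0 // => o /In_map_mem[k _ ->].
  + case: ifP => //= _; rewrite !count_cat !count_eq0 // => o /In_map_mem[k _ ->] //.
Qed.

Hypothesis Hfair : fair σ a.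

Definition alive p := forall j, ~~ crashed (σ j) p.

(** * Fairness *)

(** A nonempty outbox blocks invocations and receipts, so only an internal step of its owner can
    change it. *)
Lemma outbox_stable i p :
  outbox (σ i) p <> [::] -> a i <> AInternal p -> outbox (σ i.+1) p = outbox (σ i) p.
Proof.
move=> ne nai; rewrite outbox_step; have := step i; rewrite /emitted /remains.
case ai: (a i) => [w v|r|q|u|q|] //=.
- case: ifP => // /andP[_ /nilP Ho] _; case: eqP => // E.
  by rewrite E in ne; case: ne.
- case: ifP => // /andP[_ /nilP Ho] _; case: eqP => // E.
  by rewrite E in ne; case: ne.
- by move=> _; case: eqP => // E; case: nai; rewrite ai E.
- case: (net _ u) => [[[src dst] m]|//]; case: ifP => // /norP[_].
  rewrite negbK => /nilP Ho _; case: eqP => // E.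
  by rewrite E in ne; case: ne.
Qed.

Lemma next_internal i p : outbox (σ i) p <> [::] -> alive p ->
  exists j, [/\ i <= j, a j = AInternal p & outbox (σ j) p = outbox (σ i) p].
Proof.
move=> ne al; case: (Hfair.2 i p ne) => j [ij [aj|]]; last by rewrite (negPf (al j)).
(* The least internal step from [i] on is taken, so that the outbox is still the one seen at [i]. *)
pose P j := (i <= j) && (if a j is AInternal q then q == p else false).
have exP : exists j, P j by exists j; rewrite /P ij aj eqxx.
case: (ex_minnP exP) => k /andP[ik ak] kmin; exists k; split=> //.
  by case: (a k) ak => // q /eqP->.
have st d : i + d <= k -> outbox (σ (i + d)) p = outbox (σ i) p.
  elim: d => [|d IH] le; first by rewrite addn0.
  have E := IH ltac:(lia); rewrite addnS outbox_stable ?E // => aid.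
  have := kmin (i + d); rewrite /P aid eqxx leq_addr => /(_ isT); lia.
by rewrite -(subnKC ik) st // subnKC.
Qed.

Lemma emitted_send i p d m : headev i p (OSend d m) -> emitted i p = [::].
Proof. by case=> ai [rest Ho]; rewrite /emitted ai /emits eqxx Ho; case: p {ai Ho} => [[]|]. Qed.

Lemma emitted_return i p : headev i p OReturn -> emitted i p = [::].
Proof. by case=> ai [rest Ho]; rewrite /emitted ai /emits eqxx Ho; case: p {ai Ho} => [[]|]. Qed.

(** Executing the head can lengthen the outbox, but only a delivery does so, and it queues no
    further delivery. The induction is lexicographic: on the number of deliveries ahead of [o], then
    on the number of outputs ahead of it. *)
Lemma eventually_split i p x o y : outbox (σ i) p = x ++ o :: y -> alive p ->
  exists2 j, i <= j & headev j p o.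
Proof.
move=> Ho al; have [d] := ubnP (count (@is_del V C) x).
have [s] := ubnP (size x).
elim: d s i x Ho => [|d IHd]; first by [].
elim=> [|s IHs]; first by [].
move=> i x Ho lts ltd.
have ne : outbox (σ i) p <> [::] by rewrite Ho; case: (x).
case: (next_internal ne al) => j [ij aj Ej].
case: x Ho lts ltd => [|h x] Ho lts ltd.
  by exists j => //; split=> //; exists y; rewrite Ej Ho.
have hd : headev j p h by split=> //; exists (x ++ o :: y); rewrite Ej Ho.
case: (head_rest hd) => rest [E1 E2].
have rE : rest = x ++ o :: y by move: E1; rewrite Ej Ho => -[].
move: E2; rewrite rE catA => E2.
suff [k jk hk] : exists2 k, j.+1 <= k & headev k p o by exists k => //; lia.
case hdel: (is_del h).
  have c0 := del_AInternal aj.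
  apply: (IHd (size (emitted j p ++ x)).+1 j.+1 _ E2) => //.
  by rewrite count_cat c0; move: ltd; rewrite /= hdel; lia.
have em0 : emitted j p = [::].
  by move: hdel hd; case: (h) => // [d' m|] _ hd;
    [exact: emitted_send hd | exact: emitted_return hd].
apply: (IHs j.+1 x); first by rewrite E2 em0.
  by move: lts; rewrite /=; lia.
by move: ltd; rewrite /= hdel; lia.
Qed.

Lemma eventually_head i p o : In o (outbox (σ i) p) -> alive p ->
  exists2 j, i <= j & headev j p o.
Proof. by move=> /(@In_split _ _ _)[x [y Ho]] al; exact: eventually_split Ho al. Qed.

Lemma emitted_outbox i p o : In o (emitted i p) -> In o (outbox (σ i.+1) p).
Proof. by move=> h; rewrite outbox_step; apply/In_cat; left. Qed.

Lemma emitted_head i p o : In o (emitted i p) -> alive p -> exists2 j, i < j & headev j p o.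
Proof. by move/emitted_outbox=> h al; exact: eventually_head h al. Qed.

Lemma head_recv i p q m : headev i p (OSend q m) -> alive q ->
  exists2 j, i < j & recvev j p q m.
Proof.
case=> ai [rest Ho] al; have st := step i; rewrite ai in st.
have [Nu nE] := net_send Ho st.
have keep d : let x := net (σ (i.+1 + d)) (nuid (σ i)) in
    (x = Some (p, q, m) \/ x = None) /\ nuid (σ i) < nuid (σ (i.+1 + d)).
  elim: d => [|d [IH IH2]]; first by rewrite addn0 nE; split; [left|].
  rewrite addnS /=; split; last exact: leq_trans IH2 (nuid_next (step _)).
  case: (net_next (nuid (σ i)) (step (i.+1 + d))) => [->|[->|[E _]]] //; first by right.
  by move: IH2; rewrite E ltnn.
case: (Hfair.1 _ _ _ _ _ Nu) => j [ij [aj|]]; last by rewrite (negPf (al j)).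
exists j => //; exists (nuid (σ i)); split=> //.
(* The scheduled delivery is a legal step, hence the packet is still present at [j]. *)
have := step j; rewrite aj /=; case: (keep (j - i.+1)); rewrite subnKC //.
by case=> -> //.
Qed.

Lemma emitted_received i p q m : In (OSend q m) (emitted i p) -> alive p -> alive q ->
  exists2 j, i < j & recvev j p q m.
Proof.
move=> e ap aq; case: (emitted_head e ap) => j ij /head_recv/(_ aq)[k jk rk].
by exists k => //; exact: ltn_trans jk.
Qed.

(** A receipt queues at most one delivery and requires an empty outbox, and no other step queues
    any. *)
Lemma del_outbox i p : count (@is_del V C) (outbox (σ i) p) <= 1.
Proof.
elim: i => [|i IH]; first by rewrite init0.
case: (classic (outbox (σ i) p = [::])) => [E|ne].
  rewrite outbox_step; have -> : remains (σ i) (a i) p = [::].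
    by rewrite /remains; case: (a i) => // q; rewrite E if_same.
  by rewrite cats0; exact: del_emitted.
case: (classic (a i = AInternal p)) => [ai|nai]; last by rewrite outbox_stable.
rewrite outbox_step count_cat (del_AInternal ai) /remains ai eqxx add0n.
by apply: leq_trans IH; case: (outbox _ _) => //= h l; exact: leq_addl.
Qed.

Lemma del_head_rest i p o : headev i p o -> is_del o ->
  count (@is_del V C) (outbox (σ i.+1) p) = 0.
Proof.
move=> hd od; have [rest [E1 ->]] := head_rest hd.
rewrite count_cat (del_AInternal hd.1).
by have := del_outbox i p; rewrite E1 /= od; lia.
Qed.

Lemma sseenm_out i s m : In (OMetaDeliver m) (outbox (σ i) (PS s)) ->
  m \in sseenm (sst (σ i) s).
Proof.
case/outbox_emitted=> j ji /emitted_cause oc; inversion oc; subst.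
by case: (sst_mono s ji) => _ _ h; apply: h.
Qed.

Lemma sseenv_out i s t c : In (OValDeliver t c) (outbox (σ i) (PS s)) ->
  t \in sseenv (sst (σ i) s).
Proof.
case/outbox_emitted=> j ji /emitted_cause oc; inversion oc; subst;
  by case: (sst_mono s ji) => _ h _; apply: h.
Qed.

(* A server enters [m] in [sseenm] when it queues its only delivery of [m]. *)
Lemma meta_once i j s m : headev i (PS s) (OMetaDeliver m) ->
  headev j (PS s) (OMetaDeliver m) -> i = j.
Proof.
have gone i' j' : headev i' (PS s) (OMetaDeliver m) -> i' < j' ->
    ~ In (OMetaDeliver m) (outbox (σ j') (PS s)).
  move=> hd /subnK <-; elim: (j' - i'.+1) => [|d IH].
    rewrite add0n => /(@In_split _ _ _)[x [y E]].
    by have := del_head_rest hd erefl; rewrite E count_cat /= addnS.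
  rewrite addSn => /In_outbox_step[/emitted_cause oc|//]; inversion oc; subst.
  have := sseenm_out (head_In hd).
  case: (sst_mono s (leq_trans (leqnSn i') (leq_addl d i'.+1))) => _ _ h /h.
  by apply/negP.
move=> hi hj; case: (ltngtP i j) => // lt; first by case: (gone _ _ hi lt (head_In hj)).
by case: (gone _ _ hj lt (head_In hi)).
Qed.

Lemma sseenm_head s i m : m \in sseenm (sst (σ i) s) -> alive (PS s) ->
  exists j, headev j (PS s) (OMetaDeliver m).
Proof.
move=> + al; elim: i => [|i IH]; first by rewrite init0.
case: (sst_cases i s) => [->//|[src [m' rc]]|[t [c hd]]|[m' hd]].
- have [-> emE] := receive_server rc.
  move: emE; rewrite /srv_recv; case: m' {rc} => [op|op t|t v|t c|t|id t c|mm] emE //=;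
    try by case: ifP.
  move: emE; case: ifP => //= nm emE; rewrite inE => /orP[/eqP mE|//].
  have : In (OMetaDeliver m) (emitted i (PS s)).
    by rewrite emE; apply/In_cat; right; left; rewrite mE.
  by case/emitted_head=> // j _ hd; exists j.
- by rewrite (deliver_value hd).1.
- rewrite (deliver_meta hd).1 /meta_deliver.
  by case: m' {hd} => [[[r tr]|[r tr]]|[[t s'] r]]; repeat case: ifP => _.
Qed.

(** Both facts come from the single receipt that entered [t] in [sseenv]. The second concerns the
    relays [s <= f], which encode the value for the servers above [f]. *)
Lemma sseenv_emitted s i t : t \in sseenv (sst (σ i) s) ->
  exists2 j, j < i & (exists c, In (OValDeliver t c) (emitted j (PS s)))
    /\ (s <= f -> forall k, f < k < n -> exists c,
          In (OSend (PS k) (MValCoded t c)) (emitted j (PS s))).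
Proof.
elim: i => [|i IH]; first by rewrite init0.
move=> ti; suff: t \in sseenv (sst (σ i) s) \/
    (exists c, In (OValDeliver t c) (emitted i (PS s)))
    /\ (s <= f -> forall k, f < k < n -> exists c,
          In (OSend (PS k) (MValCoded t c)) (emitted i (PS s))).
  by case=> [/IH[j ji Qj]|Qi]; [exists j => //; exact: leqW | exists i].
move: ti {IH}; case: (sst_cases i s) => [->|[src [m' rc]]|[t' [c hd]]|[m' hd]].
- by left.
- have [-> emE] := receive_server rc.
  move: emE; rewrite /srv_recv; case: m' {rc} => [op|op t'|t' v|t' c|t'|id t' c|mm] emE /=;
    try by [left | case: ifP; left].
  + move: emE; case: ifP => /= [/andP[sf nm]|_] emE; last by left.
    rewrite inE => /orP[/eqP mE|]; last by left.
    subst t'; right; split; rewrite emE.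
      by exists (Phi s v); apply/In_cat; right; apply/In_cat; right; left.
    move=> _ k fk; exists (Phi k v); apply/In_cat; right; apply/In_cat; left.
    by apply/In_map_mem; exists k => //; rewrite mem_iota; lia.
  + move: emE; case: ifP => /= [/andP[sf nm]|_] emE; last by left.
    rewrite inE => /orP[/eqP mE|]; last by left.
    subst t'; right; split; rewrite emE; first by exists c; left.
    by lia.
- by rewrite (deliver_value hd).1; left.
- rewrite (deliver_meta hd).1 /meta_deliver.
  by case: m' {hd} => [[[r tr]|[r tr]]|[[t' s'] r]]; repeat case: ifP => _; left.
Qed.

(** * Dissemination *)

Section Fifo.
(* Outboxes are FIFO: if each output in [need] is emitted behind an output in [prov], or
   after one has left, then it never leaves its outbox before some output in [prov]. *)
Variables (need : out V C -> Prop) (prov : pid -> out V C -> Prop).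

Definition satisfied i := exists j q o, [/\ j < i, headev j q o & prov q o].

Lemma satisfiedW i j : satisfied i -> i <= j -> satisfied j.
Proof.
by case=> k [q [o [ki hd pr]]] ij; exists k, q, o; split=> //; exact: leq_trans ki ij.
Qed.

Definition preceded i p (l : seq (out V C)) := forall x o y,
  l = x ++ o :: y -> need o -> satisfied i \/ exists2 o', In o' x & prov p o'.

Hypothesis emitted_preceded : forall i p,
  (forall j q o, j <= i -> headev j q o -> need o -> satisfied j) ->
  preceded i p (emitted i p).

(** Strong induction on time, because an emission may rest on a message that left another outbox
    earlier. An entry of [prov] ahead of [o] disappears only by being executed, and this is exactly
    [satisfied]. *)
Lemma outbox_preceded i p : preceded i p (outbox (σ i) p).
Proof.
elim/ltn_ind: i p => -[|i] IH p x o y.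
  by rewrite init0; case: x.
rewrite outbox_step => /(@cat_split _ _ _ _ _ _)[[y' E]|[x' [-> E]]] no.
  have hn j q o1 : j <= i -> headev j q o1 -> need o1 -> satisfied j.
    move=> ji [_ [rest Ho]] no1; case: (IH j ji q [::] o1 rest Ho no1) => //.
    by case.
  case: (emitted_preceded hn E no) => [sat|]; last by right.
  by left; exact: satisfiedW sat (leqnSn i).
move: E; rewrite /remains.
have keep : outbox (σ i) p = x' ++ o :: y ->
    satisfied i.+1 \/ exists2 o', In o' (emitted i p ++ x') & prov p o'.
  move=> E; case: (IH i (ltnSn i) p _ _ _ E no) => [sat|[o' xo' po']].
    by left; exact: satisfiedW sat (leqnSn i).
  by right; exists o' => //; apply/In_cat; right.
case ai: (a i) => [w v|r|q|u|q|]; try exact: keep.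
case: eqP => [pq|_]; last exact: keep.
case Ho: (outbox (σ i) p) => [|h rest] /= E; first by case: x' E {keep}.
case: (IH i (ltnSn i) p (h :: x') o y) => // [|sat|[o' [<-|xo'] po']].
- by rewrite Ho E.
- by left; exact: satisfiedW sat (leqnSn i).
- by left; exists i, p, h; split=> //; split; [rewrite ai pq | exists rest].
- by right; exists o' => //; apply/In_cat; right.
Qed.

Lemma head_satisfied i p o : headev i p o -> need o -> satisfied i.
Proof.
case=> _ [rest Ho] no; case: (outbox_preceded (x := [::]) Ho no) => //.
by case.
Qed.

End Fifo.

(* If MValFull [t] goes to server [k'] then it has gone to every [k < k'], and a coded
   element or a local delivery only comes after all [f + 1] copies; hence a tag delivered
   anywhere reaches every correct server, even when writers and relays crash. *)
Definition full_sent i t k :=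
  exists j p v, j < i /\ headev j p (OSend (PS k) (MValFull t v)).

Definition needs_full t k (o : out V C) :=
  match o with
  | OSend (inr k') (MValFull t' _) => t' = t /\ k < k'
  | OSend _ (MValCoded t' _) | OValDeliver t' _ => t' = t
  | _ => False
  end.

(** [CPut] speaks of one copy only, whereas the FIFO argument needs the whole broadcast in its
    order. *)
Lemma emitted_put i w k t v : In (OSend (PS k) (MValFull t v)) (emitted i (PW w)) ->
  emitted i (PW w) = [seq OSend (PS j) (MValFull t v) | j <- iota 0 f.+1].
Proof.
have [fs fsE] : exists fs, fs = first_servers f by eexists.
rewrite -/(first_servers f) -fsE /emitted /emits; case: (a i) => [w' v'|r|q|u|q|] //.
- by case: eqP => //= _ /In_map_mem[k' _].
- by case: eqP => // <-; case: (outbox _ _) => [|[]].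
case: (net _ u) => [[[src dst] m]|] //; case: eqP => // <-.
rewrite /handled /wr_recv -fsE /=.
case: (wph _) => [|v' rs|tw acks] //=.
  case: m => [op|op t'|t' v''|t' c|t'|id t' c|mm] //=; case: srv_of => //= s.
  case: ifP => //= _.
  by case: ifP => //= _ /In_map_mem[k' _ [_ -> ->]].
case: m => [op|op t'|t' v''|t' c|t'|id t' c|mm] //=; case: srv_of => //= s.
by case: ifP => //= _; case: ifP.
Qed.

Lemma head_full_sent t k i p o : k <= f -> headev i p o -> needs_full t k o ->
  full_sent i t k.
Proof.
move=> kf hd no.
pose prov (q : pid) o := exists v, o = OSend (PS k) (MValFull t v) :> out V C.
suff H i' p' o' : headev i' p' o' -> needs_full t k o' -> satisfied prov i'.
  case: (H i p o hd no) => j [q [o' [ji hj [v oE]]]].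
  by exists j, q, v; rewrite -oE.
apply: head_satisfied => {i p o hd no} i p IH x o y E no.
have from_full src s v : recvev i src (PS s) (MValFull t v) ->
    emitted i p = x ++ o :: y -> p = PS s -> satisfied prov i \/ exists2 o', In o' x & prov p o'.
  move=> rc _ ps; have [j ji hj] := recv_sent rc.
  have [ks|ks] := leqP k s.
    left; move: ks; rewrite leq_eqVlt => /orP[/eqP ks|ks].
      by exists j, src, (OSend (PS k) (MValFull t v)); split; [|rewrite ks|exists v].
    apply: satisfiedW (ltnW ji); apply: (IH _ _ _ _ hj) => //; exact: ltnW.
  right; subst p; move: E; rewrite (receive_server rc).2 /srv_recv.
  case: ifP => [_|_] /=; last by case: x.
  move=> /(@cat_split _ _ _ _ _ _)[[y'
    /(@map_iota_split _ _ _ _ _ _ _)[k' [sk' oE h]]]|[x' [-> _]]].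
    exists (OSend (PS k) (MValFull t v)); last by exists v.
    by apply: h; move: no; rewrite oE /=; lia.
  exists (OSend (PS k) (MValFull t v)); last by exists v.
  apply/In_cat; left; apply/In_map_mem; exists k => //; rewrite mem_iota; lia.
have oc := emitted_cause (In_prefix E).
case: p o / oc E no from_full => //=.
- by move=> s q op _ _; case: q => [[]|].
- move=> w v rs tw k' _ _ _ k'f E [tE kk'] _; right; subst tw.
  move: (E); rewrite (emitted_put (In_prefix E)) => /(@map_iota_split _ _ _ _ _ _ _)[k1 [_ oE h]].
  exists (OSend (PS k) (MValFull t v)); last by exists v.
  by apply: h; move: oE => -[]; lia.
- by move=> s src t' v k' rc _ E [tE kk'] ff; subst t'; exact: ff rc E erefl.
- by move=> s src t' v k' rc _ E tE ff; subst t'; exact: ff rc E erefl.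
- by move=> s src t' v rc _ _ E tE ff; subst t'; exact: ff rc E erefl.
- move=> s src t' c rc _ _ E tE _; subst t'; left.
  have [j ji hj] := recv_sent rc.
  by apply: satisfiedW (ltnW ji); apply: (IH _ _ _ _ hj) => //; exact: ltnW.
Qed.

Lemma deliver_full_sent t c i s k : k <= f -> headev i (PS s) (OValDeliver t c) ->
  full_sent i t k.
Proof. by move=> kf hd; exact: (head_full_sent kf hd). Qed.

Definition needs_data t s r (o : out V C) :=
  (exists q, o = OSend q (MMeta (ReadDisperse t s r)))
  \/ o = OMetaDeliver (ReadDisperse t s r).

(** The element stands ahead of its announcement in the outbox of [s], so even a server that crashes
    in between cannot announce an element it has not sent. Relayed announcements lead back to that
    outbox. *)
Lemma disperse_data t s r i p o : headev i p o -> needs_data t s r o ->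
  exists j c, j < i /\ headev j (PS s) (OSend (PR r.1) (MData r t c)).
Proof.
move=> hd no.
pose prov (q : pid) o := q = PS s /\ exists c, o = OSend (PR r.1) (MData r t c) :> out V C.
suff H i' p' o' : headev i' p' o' -> needs_data t s r o' -> satisfied prov i'.
  case: (H i p o hd no) => j [q [o' [ji hj [qE [c oE]]]]].
  by exists j, c; rewrite -oE -qE.
apply: head_satisfied => {i' p' o'} {}i {hd no}p IH x {}o y E no.
have relay src q : recvev i src q (MMeta (ReadDisperse t s r)) -> satisfied prov i.
  move=> rc; have [j ji hj] := recv_sent rc.
  apply: satisfiedW (ltnW ji); apply: (IH _ _ _ _ hj); first exact: ltnW.
  by left; exists q.
have oc := emitted_cause (In_prefix E).
case: p o / oc E no => //=.
all: try by move=> *; match goal with H : needs_data _ _ _ _ |- _ => case: H => [[? //]|//] end.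
- move=> s0 t' r' k _ [c cin] E [[q [_ tE sE rE]]|//]; right.
  have {c cin} [hd|hd] : (exists c, headev i (PS s0) (OValDeliver t' c)) \/
      exists tr, headev i (PS s0) (OMetaDeliver (ReadValue r' tr)).
    have oc := emitted_cause cin; inversion oc; subst; first by left; exists c.
    by right; exists tr.
  + case: hd => c hd; move: E; rewrite (deliver_value hd).2 /val_deliver /=.
    move=> /(@cat_split _ _ _ _ _ _)[[y' ]|[x' [_]]]; last by case: x' => [|? []].
    move=> /(@flatten_split _ _ _ _ _ _ _)[[r1 tr1] [x0 [x1 [y1 [_ E ->]]]]].
    case: x1 E => [//|h x1] [<- E].
    have [k' _ [_ rE']] := In_meta_send (In_prefix E).
    apply: (ex_intro2 _ _ (OSend (PR r1.1) (MData r1 t' c))); first by apply/In_cat; right; left.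
    by split; [rewrite sE | exists c; rewrite -tE -rE rE'].
  + case: hd => tr hd; move: E; rewrite (deliver_meta hd).2 /meta_deliver /=.
    case: ifP => [_|_]; first by case: x.
    case: ifP => [_|_]; last by case: x.
    case: x => [//|h x] [<- E].
    have [k' _ [_ tE']] := In_meta_send (In_prefix E).
    exists (OSend (PR r'.1) (MData r' (stag (sst (σ i) s0)) (sval (sst (σ i) s0)))).
      by left.
    by split; [rewrite sE | exists (sval (sst (σ i) s0)); rewrite -tE -rE tE'].
- by move=> s0 src m k rc _ _ [[q [_ mE]]|//]; left; subst m; exact: relay rc.
- by move=> s0 src m rc _ _ _ [[q //]|[mE]]; left; subst m; exact: relay rc.
Qed.

(** * Correct servers and what reaches them *)

(** Crashes are permanent, so from some time [J] on every server that ever crashes has done so. The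
    servers still running at [J] are the correct ones, and the bound on crashes is applied at
    [J]. *)
Lemma correct_servers : at_most_f_server_crashes n f σ ->
  exists G, [/\ uniq G, forall s, s \in G -> s < n,
    forall s, s \in G -> alive (PS s) & n - f <= size G].
Proof.
move=> few; pose P s j := alive (PS s) \/ crashed (σ j) (PS s).
have [s j k|s _|J hJ] := @eventually_all (iota 0 n) P.
- case=> [al|cr] jk; [by left | right].
  move: jk => /subnK <-; elim: (k - j) => [|d IH] //.
  by rewrite addSn; exact: crashed_next (step _) IH.
- case: (classic (alive (PS s))) => [al|nal]; first by exists 0; left.
  apply: NNPP => nex; apply: nal => j; apply/negP => cr.
  by apply: nex; exists j; right.
exists [seq s <- iota 0 n | ~~ crashed (σ J) (PS s)]; split.
- by rewrite filter_uniq // iota_uniq.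
- by move=> s; rewrite mem_filter mem_iota => /andP[_].
- by move=> s; rewrite mem_filter => /andP[/negPf nc /hJ[//|]]; rewrite nc.
- rewrite size_filter leq_subLR.
  have := count_predC (fun s => crashed (σ J) (PS s)) (iota 0 n).
  by rewrite size_iota => {1}<-; rewrite leq_add2r; exact: few.
Qed.

Variable G : seq nat.
Hypothesis Guniq : uniq G.
Hypothesis Glt : forall s : nat, s \in G -> s < n.
Hypothesis Galive : forall s : nat, s \in G -> alive (PS s).
Hypothesis Gsize : n - f <= size G.

(* Among the first [f + 1] servers one never crashes, and it forwards to all others. *)
Lemma good_relay : exists2 g, g \in G & g <= f.
Proof.
apply: NNPP => nex.
have sub : {subset G <= iota f.+1 (n - f.+1)}.
  move=> s sG; rewrite mem_iota; have := Glt sG.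
  case: (leqP s f) => [sf|]; last by lia.
  by case: nex; exists s.
have := leq_trans Gsize (uniq_leq_size Guniq sub); rewrite size_iota; lia.
Qed.

Lemma recv_full_seen i src s t v : s <= f ->
  recvev i src (PS s) (MValFull t v) -> t \in sseenv (sst (σ i.+1) s).
Proof.
move=> sf rc; rewrite (receive_server rc).1 /srv_recv sf /=.
by case: ifPn => /=; rewrite ?inE ?eqxx // negbK.
Qed.

Lemma recv_coded_seen i src s t c : f < s ->
  recvev i src (PS s) (MValCoded t c) -> t \in sseenv (sst (σ i.+1) s).
Proof.
move=> sf rc; rewrite (receive_server rc).1 /srv_recv sf /=.
by case: ifPn => /=; rewrite ?inE ?eqxx // negbK.
Qed.

(** A correct server among the first [f + 1] receives its full copy directly; any other correct
    server receives its coded element from a correct relay. All [f + 1] copies are assumed, as it is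
    not known which relay is correct. *)
Lemma full_sent_delivered t s : (forall k, k <= f -> exists i, full_sent i t k) ->
  s \in G -> exists j c, headev j (PS s) (OValDeliver t c).
Proof.
move=> fs.
have low g : g \in G -> g <= f -> exists j, t \in sseenv (sst (σ j) g).
  move=> gG gf; have [i [j [p [v [_ hd]]]]] := fs g gf.
  have [k _ rc] := head_recv hd (Galive gG).
  by exists k.+1; exact: recv_full_seen rc.
move=> sG.
have [j seen] : exists j, t \in sseenv (sst (σ j) s).
  have [sf|sf] := leqP s f; first exact: low.
  have [g gG gf] := good_relay; have [j seen] := low g gG gf.
  have [k _ [_ coded]] := sseenv_emitted seen.
  have sn := Glt sG; case: (coded gf s) => [|c ec]; first lia.
  have [k' _ rc] := emitted_received ec (Galive gG) (Galive sG).
  by exists k'.+1; exact: recv_coded_seen rc.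
have [k _ [[c ec] _]] := sseenv_emitted seen.
by have [j' _ hd] := emitted_head ec (Galive sG); exists j', c.
Qed.

Lemma recv_meta_seen i src s m :
  recvev i src (PS s) (MMeta m) -> m \in sseenm (sst (σ i.+1) s).
Proof.
move=> rc; rewrite (receive_server rc).1 /srv_recv /=.
by case: ifPn => /=; rewrite ?inE ?eqxx // negbK.
Qed.

Lemma sseenm_emitted s i m : m \in sseenm (sst (σ i) s) -> s <= f ->
  forall k, f < k < n -> exists j, In (OSend (PS k) (MMeta m)) (emitted j (PS s)).
Proof.
move=> + sf k kfn; elim: i => [|i IH]; first by rewrite init0.
case: (sst_cases i s) => [->//|[src [m' rc]]|[t' [c hd]]|[m' hd]].
- have [-> emE] := receive_server rc.
  move: emE; rewrite /srv_recv; case: m' {rc} => [op|op t'|t' v|t' c|t'|id t' c|mm] emE //=;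
    try by case: ifP.
  move: emE; case: ifP => //= nm emE; rewrite inE => /orP[/eqP mE|//].
  exists i; rewrite emE sf mE; apply/In_cat; left; apply/In_cat; right.
  by apply/In_map_mem; exists k => //; rewrite mem_iota; lia.
- by rewrite (deliver_value hd).1.
- rewrite (deliver_meta hd).1 /meta_deliver.
  by case: m' {hd} => [[[r tr]|[r tr]]|[[t' s'] r]]; repeat case: ifP => _.
Qed.

Lemma meta_sent_delivered i p m s : In (OSend (PS s) (MMeta m)) (emitted i p) ->
  alive p -> s \in G -> exists j, headev j (PS s) (OMetaDeliver m).
Proof.
move=> e ap sG; have [k _ rc] := emitted_received e ap (Galive sG).
exact: (sseenm_head (recv_meta_seen rc) (Galive sG)).
Qed.

Lemma meta_send_delivered i p m s :
  (forall k, k <= f -> In (OSend (PS k) (MMeta m)) (emitted i p)) ->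
  alive p -> s \in G -> exists j, headev j (PS s) (OMetaDeliver m).
Proof.
move=> e ap sG; have [sf|sf] := leqP s f; first exact: meta_sent_delivered (e s sf) ap sG.
have [g gG gf] := good_relay.
have [k _ rc] := emitted_received (e g gf) ap (Galive gG).
have [|j ej] := sseenm_emitted (recv_meta_seen rc) gf (k := s); first by have := Glt sG; lia.
exact: meta_sent_delivered ej (Galive gG) sG.
Qed.

(** * Writes *)

Lemma query_emitted i p k : invokes i p -> k < n ->
  In (OSend (PS k) (MTagQuery (p, (cnt (σ i) p).+1))) (emitted i p).
Proof.
move=> inv kn; case: inv => [[w [v [-> ai]]]|[r [-> ai]]]; rewrite /emitted ai /emits eqxx;
  by apply/In_map_mem; exists k => //; rewrite mem_iota.
Qed.

Lemma tag_response i p s : invokes i p -> alive p -> s \in G ->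
  exists j t, i < j /\ recvev j (PS s) p (MTagResp (p, (cnt (σ i) p).+1) t).
Proof.
move=> inv ap sG.
have [k ik rc] := emitted_received (query_emitted inv (Glt sG)) ap (Galive sG).
have e : In (OSend p (MTagResp (p, (cnt (σ i) p).+1) (stag (sst (σ k) s)))) (emitted k (PS s)).
  by rewrite (receive_server rc).2; left.
have [j kj rj] := emitted_received e (Galive sG) ap.
by exists j, (stag (sst (σ k) s)); split=> //; exact: ltn_trans kj.
Qed.

Lemma recv_query i p s op : recvev i p (PS s) (MTagQuery op) ->
  exists j, [/\ j < i, p = op.1, s < n, invokes j p & op.2 = (cnt (σ j) p).+1].
Proof.
by case/recv_emitted=> j ji /emitted_cause oc; inversion oc; subst; exists j.
Qed.

Lemma invokes_client i s : ~ invokes i (PS s).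
Proof. by case=> [[w [v []]]|[r []]]. Qed.

(** Server identifiers range over all of [nat]. That only those below [n] take part follows from the
    destinations of the sends, and quorum intersection relies on it. *)
Lemma recv_server_lt i p s m : recvev i p (PS s) m -> s < n.
Proof.
case/recv_emitted=> j ji /emitted_cause oc; inversion oc; subst => //; try lia.
match goal with H : recvev _ _ _ (MTagQuery _) |- _ =>
  by case: (recv_query H) => j' [_ _ _ /invokes_client] end.
Qed.

Lemma recv_response i s p op t : recvev i (PS s) p (MTagResp op t) ->
  s < n /\ exists j k, [/\ j < k < i, invokes j p, op = (p, (cnt (σ j) p).+1)
                         & t = stag (sst (σ k) s)].
Proof.
case/recv_emitted=> k ki /emitted_cause oc; inversion oc; subst.
have [j [jk pE sn inv cE]] : exists j, [/\ j < k, p = op.1, s < n, invokes j p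
    & op.2 = (cnt (σ j) p).+1].
  by apply: recv_query; eassumption.
split=> //.
by exists j, k; rewrite jk ki -cE [in X in (X, _)]pE -surjective_pairing.
Qed.

(** The acknowledgment is queued by the delivery that raises the stored tag to at least [t], and
    stored tags never decrease. *)
Lemma recv_ack i s p t : recvev i (PS s) p (MAck t) ->
  s < n /\ tag_le t (stag (sst (σ i) s)).
Proof.
case/recv_emitted=> k ki /emitted_cause oc.
have {oc} [c hd] : exists c, headev k (PS s) (OValDeliver t c).
  by inversion oc; subst; exists c.
split.
  have [j _ /emitted_cause oc] := head_emitted hd.
  by inversion oc; subst; apply: recv_server_lt; eassumption.
have [le _ _] := sst_mono s ki; apply: tag_le_trans le.
rewrite (deliver_value hd).1 /val_deliver /=.
by case: ifPn => [_|]; [exact: tag_le_refl | rewrite tag_leE].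
Qed.

Lemma invoke_write_idle i w v : a i = AInvokeWrite w v -> wph (wst (σ i) w) = WIdle.
Proof.
move=> ai; have := step i; rewrite ai /=.
by case: ifP => // /andP[/andP[_]]; case: (wph _).
Qed.

Lemma cnt_mono p i j : i <= j -> cnt (σ i) p <= cnt (σ j) p.
Proof.
apply: (trace_mono (R := fun s1 s2 => cnt s1 p <= cnt s2 p)) => [s|s1 s2 s3|k].
- exact: leqnn.
- exact: leq_trans.
- case: p => [[w|r]|s] //=.
  + case: (wst_cases k w) => [->//|[src [m rc]]|[v [_ ->]]] //=.
    rewrite (receive_writer rc).1 /wr_recv.
    case: (wph _) => [|v rs|tw acks] //=;
      case: m {rc} => [op|op t'|t' v''|t' c|t'|id t' c|mm] //=;
    by case: srv_of => //= s; case: ifP => //= _; case: ifP.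
  + case: (rst_cases k r) => [->//|[src [m rc]]|[_ ->]|[_ ->]] //=.
    rewrite (receive_reader rc).1 /rd_recv.
    case: (rph _) => [|rs|tr recv|tr v] //=;
      case: m {rc} => [op|op t'|t' v''|t' c|t'|id t' c|mm] //=;
    by case: srv_of => //= s; case: ifP => //= _; case: ifP.
Qed.

Lemma cnt_invoke p i : invokes i p -> cnt (σ i.+1) p = (cnt (σ i) p).+1.
Proof.
case=> [[w [v [-> ai]]]|[r [-> ai]]] /=.
  by rewrite (wst_next w (step i)) ai eqxx.
by rewrite (rst_next r (step i)) ai eqxx.
Qed.

(** The operation counter excludes late answers to older queries, so the server read its tag after
    [i0]. *)
Lemma response_after i0 p i s t : invokes i0 p ->
  recvev i (PS s) p (MTagResp (p, (cnt (σ i0) p).+1) t) ->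
  s < n /\ exists k, [/\ i0 < k < i & t = stag (sst (σ k) s)].
Proof.
move=> inv /recv_response[sn [j [k [jk inv' [cE] tE]]]]; split=> //.
exists k; split=> //; suff : i0 <= j by lia.
rewrite leqNgt; apply/negP => lt.
by have := cnt_mono p lt; rewrite (cnt_invoke inv') -cE ltnn.
Qed.

Lemma widle_next i w : wph (wst (σ i) w) = WIdle ->
  wst (σ i.+1) w = wst (σ i) w \/ exists v, a i = AInvokeWrite w v /\
    wst (σ i.+1) w = WState (wcnt (wst (σ i) w)).+1 (WGetTag v [::]).
Proof.
move=> Hph; case: (wst_cases i w) => [|[src [m rc]]|]; [by left| |by right].
left; rewrite (receive_writer rc).1 /wr_recv Hph.
by case: m {rc}.
Qed.

Lemma wget_next i w v rs : wph (wst (σ i) w) = WGetTag v rs ->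
  wst (σ i.+1) w = wst (σ i) w \/
  exists s t, [/\ recvev i (PS s) (PW w) (MTagResp (PW w, wcnt (wst (σ i) w)) t),
    s \notin map fst rs
    & let rs' := rcons rs (s, t) in
      let tw := ((max_tag (map snd rs')).1.+1, w) in
      wst (σ i.+1) w = WState (wcnt (wst (σ i) w))
        (if majority n (size rs') then WPut tw [::] else WGetTag v rs')
      /\ (majority n (size rs') ->
          emitted i (PW w) = [seq OSend (PS j) (MValFull tw v) | j <- first_servers f])].
Proof.
move=> Hph; case: (wst_cases i w) => [|[src [m rc]]|[v' [/invoke_write_idle]]];
  [by left| |by rewrite Hph].
have [-> emE] := receive_writer rc; move: emE; rewrite /wr_recv Hph.
have [fs <-] : exists fs, fs = first_servers f by eexists.
case: m rc => [op|op t|t v'|t c|t|id t c|mm] rc; try by left.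
case: src rc => [p|s] rc /=; first by left.
case: ifP => [/andP[/eqP opE sn]|_]; last by left.
rewrite opE in rc; by case: ifP => maj emE; right; exists s, t; split=> //=; rewrite maj.
Qed.

Lemma wput_next i w tw acks : wph (wst (σ i) w) = WPut tw acks ->
  wst (σ i.+1) w = wst (σ i) w \/
  exists s, [/\ recvev i (PS s) (PW w) (MAck tw), s \notin acks
    & wst (σ i.+1) w = WState (wcnt (wst (σ i) w))
        (if n - f <= size (rcons acks s) then WIdle else WPut tw (rcons acks s))].
Proof.
move=> Hph; case: (wst_cases i w) => [|[src [m rc]]|[v' [/invoke_write_idle]]];
  [by left| |by rewrite Hph].
rewrite (receive_writer rc).1 /wr_recv Hph.
case: m rc => [op|op t|t v'|t c|t|id t c|mm] rc; try by left.
case: src rc => [p|s] rc /=; first by left.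
case: ifP => [/andP[/eqP tE sn]|_]; last by left.
subst t; right; exists s; split=> //; rewrite /kk.
by case: ifP.
Qed.

(** Besides the origin of each response, the invariant records that the writer has been in get-tag
    ever since [i0]. This forces any earlier put phase to lie before [i0]. *)
Lemma wget_inv i w v rs : wph (wst (σ i) w) = WGetTag v rs ->
  [/\ ~~ majority n (size rs), uniq (map fst rs)
    & exists i0, [/\ i0 < i, wph (wst (σ i0) w) = WIdle, invokes i0 (PW w),
        (wcnt (wst (σ i0) w)).+1 = wcnt (wst (σ i) w)
      & (forall j, i0 < j <= i -> exists rs', wph (wst (σ j) w) = WGetTag v rs')
        /\ forall s t, (s, t) \in rs -> exists2 j, j < i &
          recvev j (PS s) (PW w) (MTagResp (PW w, wcnt (wst (σ i) w)) t)]].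
Proof.
elim: i v rs => [|i IH] v rs; first by rewrite init0.
case Hph: (wph (wst (σ i) w)) => [|v' rs'|tw acks].
- case: (widle_next Hph) => [->|[v' [ai wE]]]; first by rewrite Hph.
  move=> E; have := E; rewrite wE /= => -[<- <-]; split=> //.
  exists i; split=> //; first by left; exists w, v'.
  split=> // j jl; have -> : j = i.+1 by lia.
  by rewrite wE; exists [::].
- have [nmaj un [i0 [i0i idle inv cE [all_get resp]]]] := IH _ _ Hph.
  have ext rs1 : wph (wst (σ i.+1) w) = WGetTag v' rs1 ->
      forall j, i0 < j <= i.+1 -> exists rs2, wph (wst (σ j) w) = WGetTag v' rs2.
    move=> E j jl; have [->|ne] := eqVneq j i.+1; first by exists rs1.
    by apply: all_get; lia.
  case: (wget_next Hph) => [wE|[s [t [rc sn [wE _]]]]].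
  + rewrite wE Hph => -[vE rE]; subst v' rs'; split=> //.
    exists i0; split=> //; first exact: ltnW.
    split; first by apply: (ext rs); rewrite wE.
    by move=> s t /resp[j ji rj]; exists j => //; exact: ltnW.
  + move: wE; case: ifPn => [_|nm] wE; first by rewrite wE.
    rewrite wE /= => -[vE rE]; subst v' rs; split=> //.
      by rewrite map_rcons rcons_uniq sn.
    exists i0; split=> //; first exact: ltnW.
    split; first by apply: (ext (rcons rs' (s, t))); rewrite wE.
    move=> s' t'; rewrite mem_rcons inE => /orP[/eqP[-> ->]|/resp[j ji rj]].
      by exists i.
    by exists j => //; exact: ltnW.
- case: (wput_next Hph) => [->|[s [_ _ ->]]]; first by rewrite Hph.
  by rewrite /=; case: ifP.
Qed.

Lemma wput_inv i w tw acks : wph (wst (σ i) w) = WPut tw acks ->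
  [/\ size acks < n - f, uniq acks
    & forall s, s \in acks -> exists2 j, j < i & recvev j (PS s) (PW w) (MAck tw)].
Proof.
elim: i tw acks => [|i IH] tw acks; first by rewrite init0.
case Hph: (wph (wst (σ i) w)) => [|v' rs'|tw' acks'].
- by case: (widle_next Hph) => [->|[v' [_ ->]]] //; rewrite Hph.
- case: (wget_next Hph) => [->|[s [t [_ _ [-> _]]]]]; first by rewrite Hph.
  by rewrite /=; case: ifP => // _ [_ <-]; split=> //=; lia.
- have [sz un ack] := IH _ _ Hph.
  case: (wput_next Hph) => [->|[s [rc sn ->]]].
    rewrite Hph => -[<- <-]; split=> // s /ack[j ji rj].
    by exists j => //; exact: ltnW.
  rewrite /=; case: ifPn => [_ //|]; rewrite -ltnNge => lt [tE aE].
  subst tw acks; split=> //; first by rewrite rcons_uniq sn.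
  move=> s'; rewrite mem_rcons inE => /orP[/eqP->|/ack[j ji rj]]; first by exists i.
  by exists j => //; exact: ltnW.
Qed.

Definition stored i t := exists Q, [/\ uniq Q, n - f <= size Q
  & forall s, s \in Q -> s < n /\ tag_le t (stag (sst (σ i) s))].

(** A put phase ends only with [n - f] acknowledgments, each from a server that stores [t] or a
    larger tag from then on. *)
Lemma put_until i j w t acks : wph (wst (σ i) w) = WPut t acks -> i <= j ->
  (exists acks', wph (wst (σ j) w) = WPut t acks') \/ stored j t.
Proof.
move=> Hi /subnK <-; elim: (j - i) => [|d IH]; first by left; exists acks.
rewrite addSn; set k := d + i in IH *.
case: IH => [[acks' Hk]|[Q [uQ sQ hQ]]]; last first.
  right; exists Q; split=> // s /hQ[sn le]; split=> //.
  by have [le' _ _] := sst_mono s (leqnSn k); exact: tag_le_trans le'.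
have [sz un ack] := wput_inv Hk.
case: (wput_next Hk) => [->|[s [rc sn ->]]]; first by left; exists acks'.
rewrite /=; case: leqP => [le|_]; last by left; exists (rcons acks' s).
right; exists (rcons acks' s); split=> //; first by rewrite rcons_uniq sn.
have stay s' l : l <= k -> recvev l (PS s') (PW w) (MAck t) ->
    s' < n /\ tag_le t (stag (sst (σ k.+1) s')).
  move=> lk /recv_ack[s'n le']; split=> //.
  by have [le'' _ _] := sst_mono s' (leqW lk); exact: tag_le_trans le''.
move=> s'; rewrite mem_rcons inE => /orP[/eqP->|/ack[l lk rl]]; first exact: stay rc.
exact: stay (ltnW lk) rl.
Qed.

(* The quorum storing the earlier tag meets the majority queried for the later one. *)
Lemma put_increasing j1 j0 w t1 acks1 v rs tw acks :
  wph (wst (σ j1) w) = WPut t1 acks1 -> j1 <= j0 ->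
  wph (wst (σ j0) w) = WGetTag v rs -> wph (wst (σ j0.+1) w) = WPut tw acks ->
  t1.1 < tw.1.
Proof.
move=> H1 j10 H0 H0'.
have [nmaj un [i0 [i0j idle inv cE [all_get resp]]]] := wget_inv H0.
have j1i0 : j1 <= i0.
  rewrite leqNgt; apply/negP => lt; have [|rs'] := all_get j1; first by rewrite lt.
  by rewrite H1.
case: (put_until H1 j1i0) => [[acks']|[Q [uQ sQ hQ]]]; first by rewrite idle.
case: (wget_next H0) => [E|[s [t [rc sn [E _]]]]]; first by move: H0'; rewrite E H0.
move: H0'; rewrite E /=; case: ifP => // maj [<- _] /=.
set rs' := rcons rs (s, t) in maj *.
have resp' s' t' : (s', t') \in rs' -> s' < n /\ tag_le (stag (sst (σ i0) s')) t'.
  have after l : recvev l (PS s') (PW w) (MTagResp (PW w, wcnt (wst (σ j0) w)) t') ->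
      s' < n /\ tag_le (stag (sst (σ i0) s')) t'.
    rewrite -cE => /(response_after inv)[s'n [k [i0k ->]]]; split=> //.
    by have [|le _ _] := sst_mono s' (i := i0) (j := k); first lia.
  rewrite mem_rcons inE => /orP[/eqP[sE tE]|/resp[l _]]; last exact: after.
  by subst s' t'; exact: after rc.
have [|s' s'Q|s' s'Q||s'] := quorum_meet (A := Q) (B := map fst rs') (n := n) uQ.
- by rewrite map_rcons rcons_uniq sn.
- by case: (hQ s' s'Q).
- by move: s'Q => /mapP[[s2 t2] /resp'[+ _] ->].
(* A majority of size [m] satisfies [2 * f < n < 2 * m], hence [f < m] and [n < (n - f) + m]. *)
- rewrite size_map; apply: leq_trans (leq_add sQ (leqnn _)).
  by move: maj; rewrite /majority; move: (size rs') => m; clear - Hfn; lia.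
move=> /hQ[_ le1] /mapP[[s2 t2] m2 /= sE]; subst s2.
have [_ le2] := resp' _ _ m2.
have m2' : t2 \in map snd rs' by apply/mapP; exists (s', t2).
have := tag_le_trans le1 (tag_le_trans le2 (max_tag_ge m2')).
by rewrite tag_leE /tag_lt; clear; lia.
Qed.

(** Relays copy the tag unchanged, so going back in time ends at the writer named in the tag. *)
Lemma full_origin i p q t v : In (OSend q (MValFull t v)) (emitted i p) ->
  exists2 j, j <= i & wph (wst (σ j.+1) t.2) = WPut t [::].
Proof.
elim/ltn_ind: i p q => i IH p q /emitted_cause oc; inversion oc; subst; first by exists i.
have [j ji ej] : exists2 j, j < i & In (OSend (PS s) (MValFull t v)) (emitted j src).
  by apply: recv_emitted; eassumption.
by have [l lj Hl] := IH j ji _ _ ej; exists l => //; exact: leq_trans (ltnW ji).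
Qed.

Lemma seen_origin i s t : t \in sseenv (sst (σ i) s) ->
  exists2 j, j < i & wph (wst (σ j.+1) t.2) = WPut t [::].
Proof.
case/sseenv_emitted=> j ji [[c /emitted_cause oc] _].
have from k p q v : k < i -> recvev k p q (MValFull t v) ->
    exists2 j, j < i & wph (wst (σ j.+1) t.2) = WPut t [::].
  move=> ki /recv_emitted[l lk /full_origin[l' l'l Hl']]; exists l' => //; lia.
inversion oc; subst; first by apply: from ji _; eassumption.
have [k kj /emitted_cause oc'] : exists2 k, k < j &
    In (OSend (PS s) (MValCoded t c)) (emitted k src).
  by apply: recv_emitted; eassumption.
by inversion oc'; subst; apply: (from k) => //; [lia | eassumption].
Qed.

Lemma write_completes i w v : a i = AInvokeWrite w v -> alive (PW w) ->
  exists2 j, i < j & wph (wst (σ j) w) = WIdle.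
Proof.
move=> ai al; apply: NNPP => nidle.
have busy j : i < j -> wph (wst (σ j) w) <> WIdle by move=> ij E; apply: nidle; exists j.
have inv : invokes i (PW w) by left; exists w, v.
have start : wst (σ i.+1) w = WState (wcnt (wst (σ i) w)).+1 (WGetTag v [::]).
  by rewrite (wst_next w (step i)) ai eqxx.
have [j0 [rs [tw [ij0 H0 H0' emE]]]] : exists j0 rs tw, [/\ i < j0,
    wph (wst (σ j0) w) = WGetTag v rs, wph (wst (σ j0.+1) w) = WPut tw [::]
    & tw.2 = w /\
      emitted j0 (PW w) = [seq OSend (PS j) (MValFull tw v) | j <- first_servers f]].
  apply: NNPP => nput.
  have get j : i < j -> wcnt (wst (σ j) w) = (wcnt (wst (σ i) w)).+1 /\
      exists rs, wph (wst (σ j) w) = WGetTag v rs.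
    move=> /subnK <-; elim: (j - i.+1) => [|d [IHc [rs IH]]].
      by rewrite add0n start; split=> //; exists [::].
    rewrite addSn; case: (wget_next IH) => [->|[s [t [_ _ [E emE]]]]].
      by split=> //; exists rs.
    move: E emE; case: ifP => [maj E /(_ isT) emE|_ -> _]; last first.
      by split=> //; exists (rcons rs (s, t)).
    case: nput; eexists (d + i.+1), rs, _; split; first lia.
    - exact: IH.
    - by rewrite E.
    - by split.
  (* Responses are never dropped during the phase, so the property persists and [eventually_all]
     applies. At [J] the responders include [G], a majority. *)
  pose P s j := i < j /\ exists rs, wph (wst (σ j) w) = WGetTag v rs /\ s \in map fst rs.
  have [s j k [ij [rs [Hj sj]]] /subnK <-|s sG|J hJ] := @eventually_all G P.
  - elim: (k - j) => [|d [ij' [rs' [IH sd]]]]; first by split=> //; exists rs.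
    rewrite addSn; split; first lia.
    have [_ [rs2 Hrs2]] := get (d + j).+1 ltac:(lia).
    exists rs2; split=> //; move: Hrs2.
    case: (wget_next IH) => [->|[s' [t [_ _ [-> _]]]]]; first by rewrite IH => -[<-].
    by rewrite /=; case: ifP => // _ [<-]; rewrite map_rcons mem_rcons inE sd orbT.
  - have [j [t [ij rc]]] := tag_response inv al sG.
    have [cj [rs Hj]] := get j ij; have [_ [rs' Hj']] := get j.+1 (leqW ij).
    exists j.+1; split; first exact: leqW.
    exists rs'; split=> //; move: Hj'; rewrite (receive_writer rc).1 /wr_recv Hj /= cj eqxx /=.
    case: (boolP (s \in map fst rs)) => /= sin; first by rewrite Hj => -[<-].
    by case: ifP => // _ [<-]; rewrite map_rcons mem_rcons mem_head.
  (* Only a member of [G] is wanted here, to obtain the state of the writer at [J]. *)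
  have [s0 s0G _] := good_relay.
  have [iJ [rs [HJ _]]] := hJ _ s0G.
  have [nmaj _ _] := wget_inv HJ; case/negP: nmaj.
  have sub : {subset G <= map fst rs}.
    by move=> s /hJ[_ [rs' []]]; rewrite HJ => -[<-].
  have := leq_trans Gsize (uniq_leq_size Guniq sub); rewrite size_map /majority.
  by clear - Hfn; lia.
case: emE => wE emE.
have put j : j0 < j -> exists acks, wph (wst (σ j) w) = WPut tw acks.
  move=> /subnK <-; elim: (j - j0.+1) => [|d [acks IH]]; first by exists [::].
  rewrite addSn; case: (wput_next IH) => [->|[s [_ _ E]]]; first by exists acks.
  have := busy (d + j0.+1).+1 ltac:(lia); rewrite E /=.
  by case: ifP => // _ _; exists (rcons acks s).
pose P s j := j0 < j /\ exists acks, wph (wst (σ j) w) = WPut tw acks /\ s \in acks.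
have [s j k [ij [rs' [Hj sj]]] /subnK <-|s sG|J hJ] := @eventually_all G P.
- elim: (k - j) => [|d [ij' [acks [IH sd]]]]; first by split=> //; exists rs'.
  rewrite addSn; split; first lia.
  have [acks2 H2] := put (d + j).+1 ltac:(lia).
  exists acks2; split=> //; move: H2.
  case: (wput_next IH) => [->|[s' [_ _ ->]]]; first by rewrite IH => -[<-].
  by rewrite /=; case: ifP => // _ [<-]; rewrite mem_rcons inE sd orbT.
- have fs k : k <= f -> exists l, full_sent l tw k.
    move=> kf; have e : In (OSend (PS k) (MValFull tw v)) (emitted j0 (PW w)).
      by rewrite emE; apply/In_map_mem; exists k => //; rewrite mem_iota; lia.
    have [l _ hd] := emitted_head e al.
    by exists l.+1, l, (PW w), v.
  have [j [c hd]] := full_sent_delivered fs sG.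
  (* A server acknowledges a tag once, so the delivery must not precede the put phase. If it did,
     [tw] would already have been in a put phase, and [put_increasing] would compare [tw] with
     itself. *)
  have j0j : j0 <= j.
    rewrite leqNgt; apply/negP => lt.
    have [l lj Hl] := seen_origin (sseenv_out (head_In hd)).
    rewrite wE in Hl.
    have lj0 : l.+1 <= j0 by lia.
    by have := put_increasing Hl lj0 H0 H0'; rewrite ltnn.
  have e : In (OSend (PW w) (MAck tw)) (emitted j (PS s)).
    rewrite (deliver_value hd).2 /val_deliver wE /=.
    by apply/In_cat; right; left.
  have [k jk rc] := emitted_received e (Galive sG) al.
  have j0k : j0 < k by lia.
  have [acks Hk] := put k j0k; have [acks' Hk'] := put k.+1 (leqW j0k).
  exists k.+1; split; first exact: leqW.
  exists acks'; split=> //; move: Hk'; rewrite (receive_writer rc).1 /wr_recv Hk /= eqxx /=.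
  case: (boolP (s \in acks)) => /= sin; first by rewrite Hk => -[<-].
  by case: ifP => // _ [<-]; rewrite mem_rcons mem_head.
have [s0 s0G _] := good_relay.
have [iJ [acks [HJ _]]] := hJ _ s0G.
have [sz _ _] := wput_inv HJ.
have sub : {subset G <= acks}.
  by move=> s /hJ[_ [acks' []]]; rewrite HJ => -[<-].
have := leq_trans Gsize (uniq_leq_size Guniq sub).
by rewrite leqNgt sz.
Qed.

(** * Reads *)

(** READ-DISPERSE originates at a server and is traced by [disperse_data], so no condition on a
    reader is attached to it. *)
Definition meta_origin_at j (m : meta) : Prop :=
  match m with
  | inl (inl (r, tr)) => r.2 = rcnt (rst (σ j) r.1) /\
      rst (σ j.+1) r.1 = RState (rcnt (rst (σ j) r.1)) (RGetData tr [::])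
  | inl (inr (r, tr)) => r.2 = rcnt (rst (σ j) r.1) /\
      exists v, rst (σ j.+1) r.1 = RState (rcnt (rst (σ j) r.1)) (RComplete tr v)
  | inr _ => True
  end.

Lemma meta_origin i p q m : In (OSend q (MMeta m)) (emitted i p) ->
  exists2 j, j <= i & meta_origin_at j m.
Proof.
elim/ltn_ind: i p q => i IH p q /emitted_cause oc; inversion oc; subst; try by exists i.
- by exists i => //=; split=> //; exists v.
- have [j ji ej] : exists2 j, j < i & In (OSend (PS s) (MMeta m)) (emitted j src).
    by apply: recv_emitted; eassumption.
  by have [l lj Hl] := IH j ji _ _ ej; exists l => //; exact: leq_trans (ltnW ji).
Qed.

Lemma deliver_origin i s m : headev i (PS s) (OMetaDeliver m) ->
  exists2 j, j < i & meta_origin_at j m.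
Proof.
case/head_emitted=> j ji /emitted_cause oc; inversion oc; subst.
have [l lj el] : exists2 l, l < j & In (OSend (PS s) (MMeta m)) (emitted l src).
  by apply: recv_emitted; eassumption.
by have [k kl Hk] := meta_origin el; exists k => //; lia.
Qed.

Lemma registered_origin i s r tr : (r, tr) \in sRc (sst (σ i) s) ->
  exists2 j, j < i & headev j (PS s) (OMetaDeliver (ReadValue r tr)).
Proof.
elim: i => [|i IH]; first by rewrite init0.
have {}IH : (r, tr) \in sRc (sst (σ i) s) ->
    exists2 j, j < i.+1 & headev j (PS s) (OMetaDeliver (ReadValue r tr)).
  by case/IH=> j ji hj; exists j => //; exact: ltnW.
case: (sst_cases i s) => [->//|[src [m rc]]|[t [c hd]]|[m hd]].
- rewrite (receive_server rc).1 /srv_recv.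
  by case: m {rc} => [op|op t'|t' v|t' c|t'|id t' c|mm] //=; case: ifP.
- by rewrite (deliver_value hd).1.
- rewrite (deliver_meta hd).1 /meta_deliver.
  case: m hd => [[[r' tr']|[r' tr']]|[[t' s'] r']] hd.
  + case: ifP => _ //.
    by case: ifP => _ /=; rewrite mem_rcons inE => /orP[/eqP[-> ->]|//]; exists i.
  + by case: ifP => _ //=; rewrite mem_filter => /andP[_].
  + by case: ifP => _ //=; rewrite mem_filter => /andP[_].
Qed.

Lemma data_origin i s q r t c : In (OSend q (MData r t c)) (emitted i (PS s)) ->
  exists j tr, j <= i /\ headev j (PS s) (OMetaDeliver (ReadValue r tr)).
Proof.
move/emitted_cause=> oc; inversion oc; subst; last by exists i, tr.
have [j ji hd] : exists2 j, j < i & headev j (PS s) (OMetaDeliver (ReadValue r tr)).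
  by apply: registered_origin; eassumption.
by exists j, tr; split=> //; exact: ltnW.
Qed.

Definition data_sent i s r t :=
  exists j c, j < i /\ headev j (PS s) (OSend (PR r.1) (MData r t c)).

(** The cases are the three ways to enter [sH]: a READ-COMPLETE for an unregistered read, an element
    queued by [s] itself, and an announcement from [s']. An own element is only known to be queued
    at that point, while an announced one has already left its outbox. *)
Lemma history_origin i s t s' r : (t, s', r) \in sH (sst (σ i) s) ->
  [\/ s' = s /\ exists j tr, j < i /\ headev j (PS s) (OMetaDeliver (ReadComplete r tr)),
      s' = s /\ exists j c, j < i /\ In (OSend (PR r.1) (MData r t c)) (emitted j (PS s))
    | data_sent i s' r t].
Proof.
elim: i => [|i IH]; first by rewrite init0.
have {}IH : (t, s', r) \in sH (sst (σ i) s) ->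
  [\/ s' = s /\ exists j tr, j < i.+1 /\ headev j (PS s) (OMetaDeliver (ReadComplete r tr)),
      s' = s /\ exists j c, j < i.+1 /\ In (OSend (PR r.1) (MData r t c)) (emitted j (PS s))
    | data_sent i.+1 s' r t].
  case/IH=> [[-> [j [x [ji h]]]]|[-> [j [x [ji h]]]]|[j [x [ji h]]]].
  - by constructor 1; split=> //; exists j, x; split=> //; exact: ltnW.
  - by constructor 2; split=> //; exists j, x; split=> //; exact: ltnW.
  - by constructor 3; exists j, x; split=> //; exact: ltnW.
case: (sst_cases i s) => [->//|[src [m rc]]|[t1 [c hd]]|[m hd]].
- rewrite (receive_server rc).1 /srv_recv.
  by case: m {rc} => [op|op t'|t' v|t' c|t'|id t' c|mm] //=; case: ifP.
- rewrite (deliver_value hd).1 /val_deliver /=.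
  case/mem_foldl_set_add=> [//|[[r1 tr1] rin [-> -> rE]]]; subst r1.
  constructor 2; split=> //; exists i, c; split=> //.
  rewrite (deliver_value hd).2 /val_deliver /=; apply/In_cat; left.
  by apply/In_flatten_map; exists (r, tr1) => //; left.
- rewrite (deliver_meta hd).1 /meta_deliver.
  case: m hd => [[[r' tr']|[r' tr']]|[[t' s1] r']] hd.
  + case: ifP => nH /=; first by rewrite mem_filter => /andP[_].
    case: ifP => le //=; rewrite mem_set_add => /orP[/eqP[-> -> ->]|//].
    constructor 2; split=> //; exists i, (sval (sst (σ i) s)); split=> //.
    by rewrite (deliver_meta hd).2 /meta_deliver nH le; left.
  + case: ifP => _ /=; first by rewrite mem_filter => /andP[_].
    rewrite mem_set_add => /orP[/eqP[_ -> ->]|//].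
    by constructor 1; split=> //; exists i, tr'.
  + have new : (t, s', r) \in set_add (t', s1, r') (sH (sst (σ i) s)) ->
      [\/ s' = s /\ exists j tr, j < i.+1 /\ headev j (PS s) (OMetaDeliver (ReadComplete r tr)),
          s' = s /\ exists j c, j < i.+1 /\ In (OSend (PR r.1) (MData r t c)) (emitted j (PS s))
        | data_sent i.+1 s' r t].
      rewrite mem_set_add => /orP[/eqP[-> -> ->]|//]; constructor 3.
      have [|j [c [ji hj]]] := disperse_data (t := t') (s := s1) (r := r') hd.
        by right.
      by exists j, c; split=> //; exact: ltnW.
    case: ifP => _ /=; last exact: new.
    by rewrite mem_filter => /andP[_ /new].
Qed.

Lemma history_uniq i s : uniq (sH (sst (σ i) s)).
Proof.
elim: i => [|i IH]; first by rewrite init0.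
case: (sst_cases i s) => [->//|[src [m rc]]|[t1 [c hd]]|[m hd]].
- rewrite (receive_server rc).1 /srv_recv.
  by case: m {rc} => [op|op t'|t' v|t' c|t'|id t' c|mm] //=; case: ifP.
- by rewrite (deliver_value hd).1 /val_deliver /=; exact: foldl_set_add_uniq.
- rewrite (deliver_meta hd).1 /meta_deliver.
  by case: m {hd} => [[[r' tr']|[r' tr']]|[[t' s1] r']]; repeat case: ifP => _ //=;
     rewrite ?filter_uniq ?set_add_uniq.
Qed.

Definition reports t r := fun x : (tag * nat) * rid => (x.1.1 == t) && (x.2 == r).

Lemma registered_next i s r tr : (r, tr) \in sRc (sst (σ i) s) ->
  [\/ (r, tr) \in sRc (sst (σ i.+1) s),
      exists tr', headev i (PS s) (OMetaDeliver (ReadComplete r tr'))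
    | exists t s', headev i (PS s) (OMetaDeliver (ReadDisperse t s' r)) /\
        n - f <= count (reports t r) (set_add (t, s', r) (sH (sst (σ i) s)))].
Proof.
move=> reg; case: (sst_cases i s) => [->|[src [m rc]]|[t1 [c hd]]|[m hd]].
- by constructor 1.
- constructor 1; rewrite (receive_server rc).1 /srv_recv.
  by case: m {rc} => [op|op t'|t' v|t' c|t'|id t' c|mm] //=; case: ifP.
- by constructor 1; rewrite (deliver_value hd).1 /val_deliver.
- rewrite (deliver_meta hd).1 /meta_deliver.
  case: m hd => [[[r' tr']|[r' tr']]|[[t' s1] r']] hd.
  + constructor 1; case: ifP => _ //.
    by case: ifP => _ /=; rewrite mem_rcons inE reg orbT.
  + case: (eqVneq r' r) hd => [->|ne] hd; first by constructor 2; exists tr'.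
    by constructor 1; case: ifP => _ //=; rewrite mem_filter reg andbT eq_sym.
  + case: ifP => [/andP[_ cnt_le]|_] /=; last by constructor 1.
    case: (eqVneq r' r) hd cnt_le => [->|ne] hd cnt_le; first by constructor 3; exists t', s1.
    by constructor 1; rewrite mem_filter reg andbT eq_sym.
Qed.

(** A stored tag other than [t0] was delivered somewhere, which is the starting point for spreading
    it to all correct servers. *)
Lemma stag_origin i s : stag (sst (σ i) s) = t0 \/
  exists j c, j < i /\ headev j (PS s) (OValDeliver (stag (sst (σ i) s)) c).
Proof.
elim: i => [|i IH]; first by rewrite init0; left.
have keep st : stag st = stag (sst (σ i) s) -> stag st = t0 \/
    exists j c, j < i.+1 /\ headev j (PS s) (OValDeliver (stag st) c).
  move=> ->; case: IH => [|[j [c [ji h]]]]; [by left | right].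
  by exists j, c; split=> //; exact: ltnW.
case: (sst_cases i s) => [->|[src [m rc]]|[t1 [c hd]]|[m hd]]; first exact: keep.
- apply: keep; rewrite (receive_server rc).1 /srv_recv.
  by case: m {rc} => [op|op t'|t' v|t' c|t'|id t' c|mm] //=; case: ifP.
- rewrite (deliver_value hd).1 /val_deliver /=; case: ifP => [lt|_];
    last exact: (keep _ (sst (σ i) s) erefl).
  by right; exists i, c.
- apply: keep; rewrite (deliver_meta hd).1 /meta_deliver.
  by case: m {hd} => [[[r' tr']|[r' tr']]|[[t' s1] r']]; repeat case: ifP => _ //=.
Qed.

Lemma invoke_read_idle i r : a i = AInvokeRead r -> rph (rst (σ i) r) = RIdle.
Proof.
move=> ai; have := step i; rewrite ai /=.
by case: ifP => // /andP[/andP[_]]; case: (rph _).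
Qed.

Lemma rget_next i r resp : rph (rst (σ i) r) = RGetTag resp ->
  [\/ rst (σ i.+1) r = rst (σ i) r, rph (rst (σ i.+1) r) = RIdle
   | exists s t, [/\ recvev i (PS s) (PR r) (MTagResp (PR r, rcnt (rst (σ i) r)) t),
    s \notin map fst resp
    & let resp' := rcons resp (s, t) in
      let tr := max_tag (map snd resp') in
      rst (σ i.+1) r = RState (rcnt (rst (σ i) r))
        (if majority n (size resp') then RGetData tr [::] else RGetTag resp')
      /\ (majority n (size resp') ->
          emitted i (PR r) = meta_send f (ReadValue (r, rcnt (rst (σ i) r)) tr))]].
Proof.
move=> Hph; case: (rst_cases i r) => [|[src [m rc]]|[_ ->]|[/invoke_read_idle]];
  [by constructor 1| |by constructor 2|by rewrite Hph].
have [-> emE] := receive_reader rc; move: emE; rewrite /rd_recv Hph.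
have [ms <-] : exists ms, ms = @meta_send V C f by eexists.
case: m rc => [op|op t|t v'|t c|t|id t c|mm] rc; try by constructor 1.
case: src rc => [p|s] rc /=; first by constructor 1.
case: ifP => [/andP[/eqP opE sn]|_]; last by constructor 1.
rewrite opE in rc.
by case: ifP => maj emE; constructor 3; exists s, t; split=> //=; rewrite maj.
Qed.

Lemma rdata_next i r tr recv : rph (rst (σ i) r) = RGetData tr recv ->
  [\/ rst (σ i.+1) r = rst (σ i) r, rph (rst (σ i.+1) r) = RIdle
   | exists s t c, recvev i (PS s) (PR r) (MData (r, rcnt (rst (σ i) r)) t c)
     /\ let recv' := rcons recv (s, t, c) in
        let elems := dedupf [::] [seq (x.1.1, x.2) | x <- recv' & x.1.2 == t] in
        if n - f <= size elems
        then In OReturn (emitted i (PR r)) /\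
          exists v, rst (σ i.+1) r = RState (rcnt (rst (σ i) r)) (RComplete tr v)
        else rst (σ i.+1) r = RState (rcnt (rst (σ i) r)) (RGetData tr recv')].
Proof.
move=> Hph; case: (rst_cases i r) => [|[src [m rc]]|[_ ->]|[/invoke_read_idle]];
  [by constructor 1| |by constructor 2|by rewrite Hph].
have [-> emE] := receive_reader rc; move: emE; rewrite /rd_recv Hph.
have [ms <-] : exists ms, ms = @meta_send V C f by eexists.
case: m rc => [op|op t|t v'|t c|t|id t c|mm] rc; try by constructor 1.
case: src rc => [p|s] rc /=; first by constructor 1.
case: ifP => [/eqP idE|_]; last by constructor 1.
rewrite idE in rc; rewrite /kk.
case: ifP => le emE; constructor 3; exists s, t, c; split=> //=; rewrite le //.
split; first by rewrite emE; apply/In_cat; right; left.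
by eexists.
Qed.

Lemma rget_inv i r resp : rph (rst (σ i) r) = RGetTag resp ->
  ~~ majority n (size resp) /\
  forall t, t \in map snd resp -> exists k s, t = stag (sst (σ k) s).
Proof.
elim: i resp => [|i IH] resp; first by rewrite init0.
case Hph: (rph (rst (σ i) r)) => [|resp'|tr recv|tr v].
- case: (rst_cases i r) => [->|[src [m rc]]|[_ ->]|[_ ->]] //=; first by rewrite Hph.
    by rewrite (receive_reader rc).1 /rd_recv Hph; case: m {rc}; rewrite /= ?Hph.
  by case=> <-.
- have [nmaj from] := IH _ Hph.
  case: (rget_next Hph) => [->|->|[s [t [rc sn [-> _]]]]] //.
    by rewrite Hph => -[<-].
  rewrite /=; case: ifPn => // nm [<-]; split=> // t'.
  rewrite map_rcons mem_rcons inE => /orP[/eqP->|]; last exact: from.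
  by have [_ [j [k [_ _ _ ->]]]] := recv_response rc; exists k, s.
- case: (rdata_next Hph) => [->|->|[s [t [c [rc]]]]] //; first by rewrite Hph.
  by rewrite /=; case: ifP => [_ [_ [v ->]]|_ ->].
- case: (rst_cases i r) => [->|[src [m rc]]|[_ ->]|[_ ->]] //=; first by rewrite Hph.
    by rewrite (receive_reader rc).1 /rd_recv Hph; case: m {rc}; rewrite /= ?Hph.
  by case=> <-.
Qed.

(** A receipt tests only the tag it carries, but the elements held for any other tag are unchanged,
    so the bound holds for all tags at once. *)
Lemma rdata_inv i r tr recv t : rph (rst (σ i) r) = RGetData tr recv ->
  size (dedupf [::] [seq (x.1.1, x.2) | x <- recv & x.1.2 == t]) < n - f.
Proof.
elim: i recv => [|i IH] recv; first by rewrite init0.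
case Hph: (rph (rst (σ i) r)) => [|resp'|tr' recv'|tr' v].
- case: (rst_cases i r) => [->|[src [m rc]]|[_ ->]|[_ ->]] //=; first by rewrite Hph.
  by rewrite (receive_reader rc).1 /rd_recv Hph; case: m {rc}; rewrite /= ?Hph.
- case: (rget_next Hph) => [->|->|[s [t' [rc sn [-> _]]]]] //; first by rewrite Hph.
  by rewrite /=; case: ifP => // _ [_ <-] /=; clear - Hfn; lia.
- case: (rdata_next Hph) => [->|->|[s [t' [c [rc]]]]] //.
    by rewrite Hph => -[trE <-]; apply: IH; rewrite Hph trE.
  rewrite /=; case: ifPn => [_ [_ [v ->]] //|lt -> [trE <-]].
  have [tE|ne] := eqVneq t' t; first by rewrite -tE ltnNge.
  by rewrite filter_rcons /= (negPf ne); apply: IH; rewrite Hph trE.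
- case: (rst_cases i r) => [->|[src [m rc]]|[_ ->]|[_ ->]] //=; first by rewrite Hph.
  by rewrite (receive_reader rc).1 /rd_recv Hph; case: m {rc}; rewrite /= ?Hph.
Qed.

(** * A read that never ends *)

Section StuckRead.
Variables (i r : nat).
Hypothesis invoked : a i = AInvokeRead r.
Hypothesis reader_alive : alive (PR r).
Hypothesis busy : forall j, i < j -> rph (rst (σ j) r) <> RIdle.
(** The invocation increments the counter, hence the successor. *)
Let id : rid := (r, (rcnt (rst (σ i) r)).+1).

Lemma read_start : rst (σ i.+1) r = RState id.2 (RGetTag [::]).
Proof. by rewrite (rst_next r (step i)) invoked eqxx. Qed.

(** The completing phase is excluded because [OReturn] is queued on entering it, and a live reader
    eventually executes it and becomes idle. *)
Lemma stuck_phase j : i < j -> rcnt (rst (σ j) r) = id.2 /\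
  ((exists resp, rph (rst (σ j) r) = RGetTag resp)
   \/ exists tr recv, rph (rst (σ j) r) = RGetData tr recv).
Proof.
move=> /subnK <-; elim: (j - i.+1) => [|d [IHc IH]].
  by rewrite add0n read_start; split=> //; left; exists [::].
rewrite addSn; set k := d + i.+1 in IHc IH *.
have bk : rph (rst (σ k.+1) r) <> RIdle by apply: busy; lia.
case: IH => [[resp Hph]|[tr [recv Hph]]].
  case: (rget_next Hph) => [->|//|[s [t [_ _ [-> _]]]]]; first by split=> //; left; exists resp.
  split=> //=; case: ifP => _; [right|left]; last by eexists.
  by eexists; exists [::].
case: (rdata_next Hph) => [->|//|[s [t [c [_]]]]]; first by split=> //; right; exists tr, recv.
rewrite /=; case: ifP => [_ [ret _]|_ ->]; last first.
  by split=> //; right; exists tr; eexists.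
have [l kl hd] := emitted_head ret reader_alive.
case: (busy (j := l.+1)); first by lia.
case: hd => al [rest Ho].
by rewrite (rst_next r (step l)) al eqxx Ho.
Qed.

Lemma before_read j : rcnt (rst (σ j) r) = id.2 -> i < j.
Proof.
move=> cE; rewrite ltnNge; apply/negP => ji.
have := cnt_mono (PR r) ji; rewrite /= cE ltnn.
by [].
Qed.

(** The origin of [tr] is kept because the tag finally decoded may be [tr] itself; unless it is
    [t0], some server must have stored it. *)
Lemma get_data_start : exists j0 tr, [/\ i < j0,
    forall j, i < j <= j0 -> exists resp, rph (rst (σ j) r) = RGetTag resp,
    emitted j0 (PR r) = meta_send f (ReadValue id tr),
    tr = t0 \/ exists k s, tr = stag (sst (σ k) s)
  & forall j, j0 < j -> exists recv, rph (rst (σ j) r) = RGetData tr recv].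
Proof.
have [j0 [resp [tr [ij0 get Hj0 Hj0' [emE from]]]]] : exists j0 resp tr, [/\ i < j0,
    forall j, i < j <= j0 -> exists resp, rph (rst (σ j) r) = RGetTag resp,
    rph (rst (σ j0) r) = RGetTag resp,
    rph (rst (σ j0.+1) r) = RGetData tr [::]
  & emitted j0 (PR r) = meta_send f (ReadValue id tr) /\
    (tr = t0 \/ exists k s, tr = stag (sst (σ k) s))].
  apply: NNPP => nput.
  have get d : forall j, i < j <= i.+1 + d -> exists resp, rph (rst (σ j) r) = RGetTag resp.
    elim: d => [|d IH] j jl.
      have -> : j = i.+1 by lia.
      by rewrite read_start; exists [::].
    have [jE|ne] := eqVneq j (i.+1 + d).+1; last by apply: IH; lia.
    subst j; set k := i.+1 + d in jl IH *.
    have ik : i < k by lia.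
    have [resp Hk] := IH k ltac:(lia).
    case: (rget_next Hk) => [->|E|[s [t [rc _ [E emE]]]]].
    - by exists resp.
    - by case: (busy (j := k.+1)) => //; lia.
    - move: E emE; case: ifP => [maj E /(_ isT) emE|_ -> _]; last by eexists.
      case: nput; exists k, resp; eexists; split=> //; first by rewrite E.
      split; first by rewrite emE (stuck_phase ik).1.
      case: (max_tag_mem (map snd (rcons resp (s, t)))) => [|]; first by left.
      rewrite map_rcons mem_rcons inE => /orP[/eqP ->|tin]; right.
        by have [_ [j1 [k1 [_ _ _ ->]]]] := recv_response rc; exists k1, s.
      by have [_] := rget_inv Hk; apply.
  have {}get j : i < j -> exists resp, rph (rst (σ j) r) = RGetTag resp.
    by move=> ij; apply: (get j); lia.
  have inv : invokes i (PR r) by right; exists r.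
  pose P s j := i < j /\ exists rs, rph (rst (σ j) r) = RGetTag rs /\ s \in map fst rs.
  have [s j k [ij [rs [Hj sj]]] /subnK <-|s sG|J hJ] := @eventually_all G P.
  - elim: (k - j) => [|d [ij' [rs' [IH sd]]]]; first by split=> //; exists rs.
    rewrite addSn; split; first lia.
    have [rs2 Hrs2] := get (d + j).+1 ltac:(lia).
    exists rs2; split=> //; move: Hrs2.
    case: (rget_next IH) => [->|->//|[s' [t [_ _ [-> _]]]]]; first by rewrite IH => -[<-].
    by rewrite /=; case: ifP => // _ [<-]; rewrite map_rcons mem_rcons inE sd orbT.
  - have [j [t [ij rc]]] := tag_response inv reader_alive sG.
    have [rs Hj] := get j ij; have [rs' Hj'] := get j.+1 (leqW ij).
    exists j.+1; split; first exact: leqW.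
    exists rs'; split=> //; move: Hj'.
    rewrite (receive_reader rc).1 /rd_recv Hj /= (stuck_phase ij).1 eqxx /=.
    case: (boolP (s \in map fst rs)) => /= sin; first by rewrite Hj => -[<-].
    by case: ifP => // _ [<-]; rewrite map_rcons mem_rcons mem_head.
  have [s0 s0G _] := good_relay.
  have [iJ [rs [HJ _]]] := hJ _ s0G.
  have [nmaj _] := rget_inv HJ; case/negP: nmaj.
  have sub : {subset G <= map fst rs}.
    by move=> s /hJ[_ [rs' []]]; rewrite HJ => -[<-].
  have := leq_trans Gsize (uniq_leq_size Guniq sub); rewrite size_map /majority.
  by clear - Hfn; lia.
exists j0, tr; split=> // j /subnK <-; elim: (j - j0.+1) => [|d [recv IH]].
  by exists [::].
rewrite addSn; set k := d + j0.+1 in IH *.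
have ik : i < k.+1 by lia.
have [_ ph] := stuck_phase ik.
case: (rdata_next IH) => [->|E|[s [t [c [_]]]]]; first by exists recv.
  by case: (busy ik).
rewrite /=; case: ifP => [_ [_ [v E]]|_ ->]; last by eexists.
by move: ph; rewrite E; case=> [[? //]|[? [? //]]].
Qed.

Variables (j0 : nat) (tr : tag).
Hypothesis ij0 : i < j0.
Hypothesis getting : forall j, i < j <= j0 -> exists resp, rph (rst (σ j) r) = RGetTag resp.
Hypothesis read_value : emitted j0 (PR r) = meta_send f (ReadValue id tr).
Hypothesis tr_stag : tr = t0 \/ exists k s, tr = stag (sst (σ k) s).
Hypothesis waiting : forall j, j0 < j -> exists recv, rph (rst (σ j) r) = RGetData tr recv.

Lemma no_read_complete j s tr' : ~ headev j (PS s) (OMetaDeliver (ReadComplete id tr')).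
Proof.
case/deliver_origin=> k kj /= [/esym cE [v E]].
have ik := before_read cE.
by case: (stuck_phase (leqW ik)) => _; rewrite E; case=> [[? //]|[? [? //]]].
Qed.

Lemma read_value_delivered j s tr' :
  headev j (PS s) (OMetaDeliver (ReadValue id tr')) -> tr' = tr /\ j0 < j.
Proof.
case/deliver_origin=> k kj /= [/esym cE E].
have ik := before_read cE.
have j0k : j0 < k.+1.
  rewrite ltnNge; apply/negP => kj0; have [|resp] := getting (j := k.+1); first lia.
  by rewrite E.
have [recv] := waiting j0k; rewrite E /= => -[-> _]; split=> //; lia.
Qed.

(** The reader ignores elements outside its get-data phase. None is lost this way, since a server
    sends them only after delivering a READ-VALUE of this read. *)
Lemma data_after j s t c : recvev j (PS s) (PR r) (MData id t c) -> j0 < j.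
Proof.
case/recv_emitted=> k kj /data_origin[l [tr' [lk /read_value_delivered[_ j0l]]]].
lia.
Qed.

(** Collected elements are kept while the reader waits, so at one moment it would hold elements of
    tag [t] from all of [S], against [rdata_inv]. *)
Lemma no_quorum S t : uniq S -> n - f <= size S ->
  ~ forall s, s \in S -> exists j c, recvev j (PS s) (PR r) (MData id t c).
Proof.
move=> uS sS ans.
pose P s j := j0 < j /\ exists recv, rph (rst (σ j) r) = RGetData tr recv /\
  s \in map fst [seq (x.1.1, x.2) | x <- recv & x.1.2 == t].
have [s j k [ij [rs [Hj sj]]] /subnK <-|s sG|J hJ] := @eventually_all S P.
- elim: (k - j) => [|d [ij' [rs' [IH sd]]]]; first by split=> //; exists rs.
  rewrite addSn; split; first lia.
  have [rs2 Hrs2] := waiting (j := (d + j).+1) ltac:(lia).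
  exists rs2; split=> //; move: Hrs2.
  case: (rdata_next IH) => [->|->//|[s' [t' [c [_]]]]]; first by rewrite IH => -[<-].
  rewrite /=; case: ifP => [_ [_ [v ->]]//|_ -> [<-]].
  by rewrite filter_rcons; case: ifP => _ //; rewrite !map_rcons mem_rcons inE sd orbT.
- have [j [c rc]] := ans s sG.
  have j0j := data_after rc.
  have [rs Hj] := waiting j0j; have [rs' Hj'] := waiting (leqW j0j).
  exists j.+1; split; first exact: leqW.
  exists rs'; split=> //; move: Hj'.
  have [cE _] := stuck_phase (ltn_trans ij0 j0j).
  rewrite (receive_reader rc).1 /rd_recv Hj cE.
  have [ms <-] : exists ms, ms = @meta_send V C f by eexists.
  rewrite /= eqxx /=.
  by case: ifP => //= _ [<-]; rewrite filter_rcons /= eqxx !map_rcons mem_rcons mem_head.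
have [s0 s0S] : exists s, s \in S.
  case: S sS {uS ans hJ} => [|s S] sS; last by exists s; rewrite mem_head.
  by move: sS; rewrite /=; clear - Hfn; lia.
have [iJ [recv [HJ _]]] := hJ _ s0S.
have lt := rdata_inv t HJ.
have sub : {subset S <= map fst (dedupf [::] [seq (x.1.1, x.2) | x <- recv & x.1.2 == t])}.
  by move=> s /hJ[_ [rs' []]]; rewrite HJ => -[<-] /mem_dedupf; apply.
have := leq_trans sS (uniq_leq_size uS sub).
by rewrite size_map leqNgt lt.
Qed.

Lemma data_sent_received j s t : data_sent j s id t ->
  exists k c, recvev k (PS s) (PR r) (MData id t c).
Proof.
case=> k [c [_ hd]]; have [l _ rc] := head_recv hd reader_alive.
by exists l, c.
Qed.

Lemma history_received j s t s' : s \in G -> (t, s', id) \in sH (sst (σ j) s) ->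
  exists k c, recvev k (PS s') (PR r) (MData id t c).
Proof.
move=> sG /history_origin[[_ [k [tr' [_ /no_read_complete[]]]]]|[-> [k [c [_ e]]]]|].
  have [l _ rc] := emitted_received e (Galive sG) reader_alive.
  by exists l, c.
exact: data_sent_received.
Qed.

(* The [k] triples that would unregister the read witness [k] coded elements with one tag
   sent to the reader. *)
Lemma no_unregister j s t s' : s \in G ->
  headev j (PS s) (OMetaDeliver (ReadDisperse t s' id)) ->
  ~ n - f <= count (reports t id) (set_add (t, s', id) (sH (sst (σ j) s))).
Proof.
move=> sG hd; set H' := set_add _ _ => le.
pose S := [seq x.1.2 | x <- H' & reports t id x].
apply: (@no_quorum S t).
(* With tag and read fixed, a triple is determined by its server, so counting triples counts
   distinct servers. *)
- rewrite map_inj_in_uniq; first by rewrite filter_uniq // set_add_uniq // history_uniq.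
  move=> [[t1 s1] r1] [[t2 s2] r2]; rewrite !mem_filter /reports /=.
  by move=> /andP[/andP[/eqP-> /eqP->] _] /andP[/andP[/eqP-> /eqP->] _] ->.
- by rewrite size_map size_filter.
move=> s1 /mapP[[[t1 s2] r1]]; rewrite mem_filter /reports /=.
case/andP=> /andP[/eqP-> /eqP->] + ->; rewrite mem_set_add => /orP[/eqP[->]|].
  have [|k [c [kj hk]]] := disperse_data (t := t) (s := s') (r := id) hd.
    by right.
  by apply: (@data_sent_received j); exists k, c.
exact: history_received.
Qed.

Lemma read_value_reaches s : s \in G ->
  exists j, headev j (PS s) (OMetaDeliver (ReadValue id tr)).
Proof.
move=> sG; have e k : k <= f ->
    In (OSend (PS k) (MMeta (ReadValue id tr))) (emitted j0 (PR r)).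
  by move=> kf; rewrite read_value; apply/In_map_mem; exists k => //; rewrite mem_iota; lia.
exact: (meta_send_delivered e reader_alive sG).
Qed.

(* A triple with the server's own index is left in [H] either by READ-COMPLETE or by
   sending data to the reader; the former needs the read to be over, the latter needs an
   earlier delivery of the same READ-VALUE. *)
Lemma fresh_registration j s t : headev j (PS s) (OMetaDeliver (ReadValue id tr)) ->
  (t, s, id) \notin sH (sst (σ j) s).
Proof.
move=> hd; apply/negP => /history_origin.
have absurd k c : k < j -> In (OSend (PR id.1) (MData id t c)) (emitted k (PS s)) -> False.
  move=> kj /data_origin[l [tr' [lk hl]]].
  have [trE _] := read_value_delivered hl; subst tr'.
  by have := meta_once hl hd; lia.
case=> [[_ [k [tr' [_ /no_read_complete[]]]]]|[_ [k [c [kj e]]]]|[k [c [kj hk]]]].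
  exact: absurd kj e.
by have [l lk e] := head_emitted hk; exact: absurd (ltn_trans lk kj) e.
Qed.

Lemma registered_forever j s k : s \in G ->
  headev j (PS s) (OMetaDeliver (ReadValue id tr)) -> j < k ->
  (id, tr) \in sRc (sst (σ k) s).
Proof.
move=> sG hd /subnK <-; elim: (k - j.+1) => [|d IH].
  rewrite add0n (deliver_meta hd).1 /meta_deliver /= (negPf (fresh_registration _ hd)).
  by case: ifP => _ /=; rewrite mem_rcons mem_head.
rewrite addSn; case: (registered_next IH) => [//|[tr' /no_read_complete[]]|[t [s' [hd' le]]]].
by case: (no_unregister sG hd' le).
Qed.

Lemma stuck_absurd : False.
Proof.
(* [tm] is the largest of [tr] and of the tags stored by the correct servers when they
   register the read: each of them sends its element for [tm], at once if it stores [tm],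
   and otherwise when the dissemination of [tm] reaches it. *)
pose P s t := exists2 j, headev j (PS s) (OMetaDeliver (ReadValue id tr)) &
  t = stag (sst (σ j) s).
have [s sG|tm [tr_le from up]] := @max_among G P tr.
  by have [j hj] := read_value_reaches sG; exists (stag (sst (σ j) s)), j.
apply: (@no_quorum G tm Guniq Gsize) => s sG.
suff [j [c e]] : exists j c, In (OSend (PR r) (MData id tm c)) (emitted j (PS s)).
  have [k _ rc] := emitted_received e (Galive sG) reader_alive.
  by exists k, c.
have [_ [j hj ->] le] := up s sG.
have [tE|ne] := eqVneq (stag (sst (σ j) s)) tm.
  exists j, (sval (sst (σ j) s)).
  rewrite (deliver_meta hj).2 /meta_deliver /= (negPf (fresh_registration _ hj)) tE tr_le.
  by left.
(* If [tm] were [t0], the smaller tag stored at [s] would equal it, against [ne]. Hence [tm] was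
   once delivered, and its dissemination reaches [s]. *)
have tm0 : tm <> t0.
  by move=> E; case/eqP: ne; apply: tag_le_anti => //; rewrite E t0_le.
have [k [s' tmE]] : exists k s', tm = stag (sst (σ k) s').
  case: from => [tmE|[s' _ [k _ ->]]]; last by exists k, s'.
  by rewrite tmE; case: tr_stag => // trE; case: tm0; rewrite tmE.
case: (stag_origin k s'); rewrite -tmE // => -[l [c [_ hl]]].
have fs q : q <= f -> exists l', full_sent l' tm q.
  by move=> qf; exists l; exact: (deliver_full_sent qf hl).
have [l' [c' hd]] := full_sent_delivered fs sG.
(* The delivery of [tm] finds the read registered: had it come earlier, [s] would have stored at
   least [tm] at registration, hence exactly [tm] by maximality. The two deliveries cannot coincide,
   since a step executes a single output. *)
have jl' : j < l'.
  rewrite ltnNge leq_eqVlt; apply/negP => /orP[/eqP lj|lj].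
    by by subst l'; case: hd => _ [rest E]; case: hj => _ [rest']; rewrite E.
  case/eqP: ne; apply: tag_le_anti => //.
  have [le' _ _] := sst_mono s lj; apply: tag_le_trans le'.
  rewrite (deliver_value hd).1 /val_deliver /=.
  by case: ifPn => [_|]; [exact: tag_le_refl | rewrite tag_leE].
exists l', c'; rewrite (deliver_value hd).2 /val_deliver /=; apply/In_cat; left.
apply/In_flatten_map; exists (id, tr); last by left.
by rewrite mem_filter tr_le (registered_forever sG hj jl').
Qed.

End StuckRead.

Lemma read_completes i r : a i = AInvokeRead r -> alive (PR r) ->
  exists2 j, i < j & rph (rst (σ j) r) = RIdle.
Proof.
move=> ai al; apply: NNPP => nidle.
have busy j : i < j -> rph (rst (σ j) r) <> RIdle by move=> ij E; apply: nidle; exists j.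
have [j0 [tr [ij0 get emE from wait]]] := get_data_start ai al busy.
exact: (stuck_absurd ai al busy ij0 get emE from wait).
Qed.

End Soda.

Theorem theorem3
  (V C : Type) (v0 : V) (n f : nat) (Phi : nat -> V -> C) (Dec : seq (nat * C) -> V)
  (Hf1 : 1 <= f) (Hfn : 2 * f + 1 <= n)

  (HMDS : forall (v : V) (S : seq nat), uniq S -> all (fun s => s < n) S ->
            size S = n - f -> Dec [seq (s, Phi s v) | s <- S] = v)
  (σ : nat -> state V C) (a : nat -> action V)
  (Hexec : execution v0 n f Phi Dec σ a)
  (Hfair : fair σ a)
  (Hcrash : at_most_f_server_crashes n f σ) :
  (forall i w v, a i = AInvokeWrite w v ->
     (forall j, ~~ crashed (σ j) (PW w)) ->
     exists j, i < j /\ wph (wst (σ j) w) = WIdle)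
  /\
  (forall i r, a i = AInvokeRead V r ->
     (forall j, ~~ crashed (σ j) (PR r)) ->
     exists j, i < j /\ rph (rst (σ j) r) = RIdle).
Proof.
have [G [Guniq Glt Galive Gsize]] := correct_servers Hexec Hcrash.
split=> [i w v ai al|i r ai al].
  have [j ij idle] := write_completes Hfn Hexec Hfair Guniq Glt Galive Gsize ai al.
  by exists j.
have [j ij idle] := read_completes Hfn Hexec Hfair Guniq Glt Galive Gsize ai al.
by exists j.
Qed.
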